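(* Let $\delta\ge 0$ and let $(X,k_X)$ be a quasihyperbolic metric space that is Gromov $\delta$-hyperbolic. Let $a,b\in\partial_\infty X$ with $a\neq b$, and let $h>0$. Then there is a sequence of arcs $\alpha_i: x_i\curvearrowright y_i$ $(i=1,2,3,\dots)$ in $X$, where $\{x_i\}\in a$ and $\{y_i\}\in b$, with the following properties: (1) each $\alpha_i$ is a quasihyperbolic $h$-short arc; (2) for some $s_1\in\alpha_1$, $k_X(x_i,s_1)\to\infty$ and $k_X(y_i,s_1)\to\infty$ as $i\to\infty$; (3) for all $i\le j$ there is a length map $f_{ij}:\alpha_i\to\alpha_j$ such that $f_{ii}=\mathrm{id}$ for every $i$ and $f_{im}=f_{jm}\circ f_{ij}$ whenever $i\le j\le m$; (4) these maps satisfy $k_X(f_{ij}(u),u)\le 12(\delta+h)$ for all $u\in\alpha_i$ and all $i\le j$.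
   Context: Quasihyperbolic metric space: $X$ is a rectifiably connected open subset, with nonempty boundary $\partial X$, of a metric space; rectifiably connected means that any two points of $X$ can be joined by a rectifiable curve in $X$ (a curve is a continuous map from a compact interval; it is rectifiable if its length with respect to the given metric is finite). Put $\delta_X(x)=\mathrm{dist}(x,\partial X)$ for $x \in X$. The quasihyperbolic length of a rectifiable curve $\gamma$ in $X$ is $l_{k_X}(\gamma)=\int_\gamma \frac{ds}{\delta_X(x)}$ (integration with respect to arc length), and the quasihyperbolic metric is $k_X(x,y)=\inf_\gamma l_{k_X}(\gamma)$, the infimum being over all rectifiable curves $\gamma$ in $X$ joining $x$ and $y$. This is a metric on $X$. Gromov hyperbolicity: for $x,y,\omega\in X$ the Gromov product is $(x|y)_\omega=\frac12\big(k_X(x,\omega)+k_X(y,\omega)-k_X(x,y)\big)$. The space $(X,k_X)$ is Gromov $\delta$-hyperbolic ($\delta\ge0$) if $(x|y)_\omega\ge\min\{(x|z)_\omega,(z|y)_\omega\}-\delta$ for all $x,y,z,\omega\in X$. Gromov boundary: fix a base point $\omega\in X$. A sequence $\{x_i\}$ in $X$ is a Gromov sequence if $(x_i|x_j)_\omega\to\infty$ as $i,j\to\infty$. Two Gromov sequences $\{x_i\},\{y_i\}$ are equivalent if $(x_i|y_i)_\omega\to\infty$ as $i\to\infty$. In a Gromov hyperbolic space this is an equivalence relation, and these notions do not depend on $\omega$. The Gromov boundary $\partial_\infty X$ is the set of equivalence classes of Gromov sequences. Arcs: an arc in $X$ is a subset homeomorphic to a compact real interval; $\alpha:x\curvearrowright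 y$ means that $\alpha$ is an arc with endpoints $x$ and $y$. For $u,v\in\alpha$, $\alpha|_{[u,v]}$ is the closed subarc of $\alpha$ between $u$ and $v$ (a single point, of length $0$, if $u=v$). For $h\ge0$, a (rectifiable) arc $\gamma:x\curvearrowright y$ is a quasihyperbolic $h$-short arc if $l_{k_X}(\gamma)\le k_X(x,y)+h$. Length map: for rectifiable arcs $\alpha,\beta$ in $X$ with $l_{k_X}(\alpha)\le l_{k_X}(\beta)$, a map $f:\alpha\to\beta$ is a length map if $l_{k_X}\big(\beta|_{[f(u),f(v)]}\big)=l_{k_X}\big(\alpha|_{[u,v]}\big)$ for all $u,v\in\alpha$. *)

(* Defs.v *)
From HB Require Import structures.
From mathcomp Require Import all_boot all_order all_algebra.
From mathcomp Require Import all_classical all_reals all_analysis.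

Set Implicit Arguments.
Unset Strict Implicit.
Unset Printing Implicit Defensive.

Import Order.TTheory GRing.Theory Num.Theory.
Import numFieldNormedType.Exports.

Local Open Scope classical_set_scope.
Local Open Scope ring_scope.

(** Curves.  A curve is a function [g : R -> T] considered on an interval
    [[a, b]]; its values outside the interval are irrelevant. *)

Section Curves.
Context {R : realType} {T : metricType R}.
Implicit Types (g : R -> T) (a b : R) (X : set T) (x y : T).

(* metric analogue of [variation] for the partition a :: s of [a, b] *)
Definition polygonal_length g a (s : seq R) : R :=
  let F := g \o nth a (a :: s) in
  \sum_(0 <= n < size s) mdist (F n) (F n.+1).

Definition curve_length g a b : \bar R :=
  ereal_sup [set (polygonal_length g a s)%:E | s in itv_partition a b].

Definition rectifiable_on g a b : Prop := (curve_length g a b < +oo)%E.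

Definition rectifiable_curve X x y g a b : Prop :=
  [/\ a <= b, {within `[a, b], continuous g}, g @` `[a, b] `<=` X,
      g a = x /\ g b = y & rectifiable_on g a b].

Definition rectifiably_connected X : Prop :=
  forall x y, X x -> X y -> exists g a b, rectifiable_curve X x y g a b.

(* The point of the curve reached after arc length [t]; it does not depend on
   the choice of the parameter [u], since the curve is constant between two
   parameters at the same arc length. *)
Definition arclength_param g a b (t : R) : T :=
  g (xget a [set u | u \in `[a, b] /\ curve_length g a u = t%:E]).

(* integral of [f] over a rectifiable curve with respect to arc length *)
Definition curve_integral (f : T -> R) g a b : R :=
  \int[lebesgue_measure]_(t in `[0, fine (curve_length g a b)])
     f (arclength_param g a b t).

End Curves.

Section Quasihyperbolic.
Context {R : realType} {T : metricType R}.
Implicit Types (X A : set T) (x y w : T) (g : R -> T).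

Definition boundary A : set T := closure A `\` interior A.

Definition dist_boundary X x : R := inf [set mdist x z | z in boundary X].

Definition quasihyperbolic_domain X : Prop :=
  [/\ open X, boundary X !=set0 & rectifiably_connected X].

Definition qh_length X g a b : R :=
  curve_integral (fun x => (dist_boundary X x)^-1) g a b.

Definition qh_dist X x y : R :=
  inf [set l | exists g a b,
         rectifiable_curve X x y g a b /\ l = qh_length X g a b].

Definition gromov_product X w x y : R :=
  (qh_dist X x w + qh_dist X y w - qh_dist X x y) / 2.

Definition gromov_hyperbolic X (delta : R) : Prop :=
  forall x y z w, X x -> X y -> X z -> X w ->
    Num.min (gromov_product X w x z) (gromov_product X w z y) - delta
      <= gromov_product X w x y.

Definition gromov_sequence X w (x : nat -> T) : Prop :=
  (forall i, X (x i)) /\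
  gromov_product X w (x p.1) (x p.2) @[p --> (\oo, \oo)] --> +oo.

Definition gromov_equivalent X w (x y : nat -> T) : Prop :=
  gromov_product X w (x i) (y i) @[i --> \oo] --> +oo.

(* A boundary point is an equivalence class, i.e. a set of sequences. *)
Definition gromov_boundary X w : set (set (nat -> T)) :=
  [set [set y | gromov_sequence X w y /\ gromov_equivalent X w x y]
     | x in gromov_sequence X w].

End Quasihyperbolic.

(** Arcs.  An arc is a subset of the space together with a homeomorphism from
    [[0, 1]] onto it and the inverse homeomorphism. *)

Record metric_arc (R : realType) (T : metricType R) := Arc {
  arc_map : R -> T;
  arc_coord : T -> R;
  arc_mapK : {in `[0, 1], cancel arc_map arc_coord};
  arc_map_continuous : {within `[0, 1], continuous arc_map};
  arc_coord_continuous : {within arc_map @` `[0, 1], continuous arc_coord}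
}.

Section Arcs.
Context {R : realType} {T : metricType R}.
Implicit Types (X : set T) (x y u v : T) (alpha beta : metric_arc T).

Definition arc_set alpha : set T := arc_map alpha @` `[0, 1].

Definition arc_in X x y alpha : Prop :=
  [/\ arc_map alpha 0 = x, arc_map alpha 1 = y & arc_set alpha `<=` X].

Definition arc_rectifiable alpha : Prop := rectifiable_on (arc_map alpha) 0 1.

Definition arc_qh_length X alpha : R := qh_length X (arc_map alpha) 0 1.

(* quasihyperbolic length of the closed subarc between [u] and [v] *)
Definition subarc_qh_length X alpha u v : R :=
  let s := arc_coord alpha u in
  let t := arc_coord alpha v in
  qh_length X (arc_map alpha) (Num.min s t) (Num.max s t).

Definition qh_short_arc X (h : R) x y alpha : Prop :=
  [/\ arc_in X x y alpha, arc_rectifiable alpha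
    & arc_qh_length X alpha <= qh_dist X x y + h].

Definition length_map X alpha beta (f : T -> T) : Prop :=
  [/\ arc_qh_length X alpha <= arc_qh_length X beta,
      f @` arc_set alpha `<=` arc_set beta
    & forall u v, arc_set alpha u -> arc_set alpha v ->
        subarc_qh_length X beta (f u) (f v) = subarc_qh_length X alpha u v].

End Arcs.

(* Main.v *)
(* The quasihyperbolic length of a curve is the unique additive interval function
   comparable with arc length through the bounds of 1/dist_boundary; this makes
   it invariant under reparametrization.  An ultrafilter limit of almost shortest
   curves inside the compact image of a given curve is an injective curve that is
   not longer, so any two points are joined by an h-short arc parametrized by
   quasihyperbolic length.

   Let beta_n be such arcs joining the n-th terms of sequences representing a
   and b.  Since a <> b, one of them, far out in the sequence, has a point o near
   the base point, and (x_n|y_n)_o <= h/2 + 2 delta for all later n; hence beta_n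
   has a point s_n with k(s_n, o) <= 4 delta + 3h/2.  Comparing the functions
   k(., x_n) for different n by the four point condition, points of beta_i and
   beta_j at the same signed length from s_i and s_j are at distance at most
   k(s_i, s_j) + 4 delta + 2h <= 12 delta + 5h, as long as that length is small
   compared with the Gromov products of the endpoints.  Along a subsequence n_i
   one may therefore take for alpha_i the subarc of beta_{n_i} of length 2(i + 1)
   centred at s_{n_i}, and for f_ij the translation of the signed length. *)
Require Import Defs.
From mathcomp Require Import all_boot all_order all_algebra.
From mathcomp Require Import all_classical all_reals all_analysis.
From mathcomp Require Import ring lra.
Import Order.TTheory GRing.Theory Num.Theory.
Import numFieldNormedType.Exports.
Local Open Scope classical_set_scope.
Local Open Scope ring_scope.
Set Implicit Arguments.
Unset Strict Implicit.
Unset Printing Implicit Defensive.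

(** * Length of curves in a metric space *)

(** The final constant may depend on delta and h only, whereas (x_n|y_n)_w depends on the base point
    w and may be large. Hence the passage to a point o of an h-short arc joining one pair of terms:
    seen from o the product of the two ends is at most h/2, and far terms of both sequences inherit
    this bound with two losses of delta. The balanced point s_n of beta_n costs another h + 2 delta,
    and the detour from s_i to s_j through o doubles the sum, which gives 8 delta + 3h.

    The arcs are cut down to a central part because beta_i and beta_j can be compared only where
    their ends lie in the same direction. The relation between f_im, f_jm and f_ij is then
    automatic, since every map preserves signed length.

    X is not assumed locally compact, so limits of curves need not exist in X. Compactness is
    available in the parameter interval of one given curve; this is why lengths are minimized inside
    its image, for an inner distance. *)

Section IntervalInduction.
Context {R : realType}.

(* Cousin's lemma. *)
Lemma interval_induction (E : R -> R -> Prop) (a b : R) : a <= b ->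
  (forall s m t, a <= s -> s <= m -> m <= t -> t <= b ->
    E s m -> E m t -> E s t) ->
  (forall c, a <= c -> c <= b -> exists2 e : R, 0 < e & forall s t, a <= s ->
    s <= c -> c <= t -> t <= b -> c - e < s -> t < c + e -> E s t) ->
  E a b.
Proof.
move=> ab Eadd Eloc.
pose S := [set t | [/\ a <= t, t <= b & E a t]].
have Sa : S a.
  split=> //; have [e e0 H] := Eloc a (lexx a) ab.
  by apply: H => //; lra.
have hS : has_sup S by split; [exists a|exists b => t [_ + _]].
pose c := sup S.
have ac : a <= c by exact: ub_le_sup hS.2 _ Sa.
have cb : c <= b by apply: ge_sup => [|t [_ + _]]; [exists a|].
have [e e0 H] := Eloc c ac cb.
have [t St ct] := sup_adherent e0 hS.
have tc : t <= c by exact: ub_le_sup hS.2 _ St.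
have [at_ tb Et] := St.
have [be|be] := leP b (c + e / 2).
  apply: (Eadd a t b) => //; apply: H => //; lra.
have : S (c + e / 2).
  split; [lra|lra|].
  apply: (Eadd a t) => //; [lra|lra|].
  by apply: H => //; lra.
by move=> /(ub_le_sup hS.2); rewrite -/c; lra.
Qed.

End IntervalInduction.

Section CurveLength.
Context {R : realType} {T : metricType R}.
Implicit Types (g : R -> T) (a b c u v : R).

Definition len g a b : R := fine (curve_length g a b).

Lemma polygonal_length_nil g a : polygonal_length g a [::] = 0.
Proof. by rewrite /polygonal_length big_geq. Qed.

Lemma polygonal_length_cons g a x (s : seq R) :
  polygonal_length g a (x :: s) = mdist (g a) (g x) + polygonal_length g x s.
Proof.
rewrite /polygonal_length big_nat_recl//=; congr (_ + _).
rewrite !big_nat; apply: eq_bigr => n /andP[_ ns]; congr (mdist (g _) (g _)).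
  by apply: set_nth_default; rewrite /= ltnS ltnW.
exact: set_nth_default.
Qed.

Lemma polygonal_length_cat g a (s t : seq R) :
  polygonal_length g a (s ++ t) =
  polygonal_length g a s + polygonal_length g (last a s) t.
Proof.
elim: s a => [|x s ih] a /=; first by rewrite polygonal_length_nil add0r.
by rewrite !polygonal_length_cons ih addrA.
Qed.

Lemma polygonal_length_le g (F : R -> R) a b (s : seq R) :
  itv_partition a b s ->
  (forall u v, a <= u -> u <= v -> v <= b -> mdist (g u) (g v) <= F v - F u) ->
  polygonal_length g a s <= F b - F a.
Proof.
elim: s a => [|x s ih] a.
  by move=> /itv_partition_nil -> _; rewrite polygonal_length_nil subrr.
move=> abs H; have [/= /andP[ax _] _] := abs.
have xbs := itv_partition_cons abs.
have xb := itv_partition_le xbs.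
rewrite polygonal_length_cons.
have := H a x (lexx _) (ltW ax) xb.
have := ih x xbs (fun u v xu uv vb => H u v (le_trans (ltW ax) xu) uv vb).
lra.
Qed.

Lemma curve_length_le g (F : R -> R) a b :
  (forall u v, a <= u -> u <= v -> v <= b -> mdist (g u) (g v) <= F v - F u) ->
  (curve_length g a b <= (F b - F a)%:E)%E.
Proof.
move=> H; apply: ub_ereal_sup => _ [s abs <-].
by rewrite lee_fin; exact: polygonal_length_le.
Qed.

Lemma curve_length_ge_mdist g a b : a <= b ->
  ((mdist (g a) (g b))%:E <= curve_length g a b)%E.
Proof.
rewrite le_eqVlt => /predU1P[<-|ab]; apply: ereal_sup_ubound => /=.
  exists [::]; last by rewrite polygonal_length_nil mdistxx.
  by split.
exists [:: b]; first exact: itv_partition1.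
by rewrite polygonal_length_cons polygonal_length_nil addr0.
Qed.

Lemma curve_length_ge0 g a b : a <= b -> (0 <= curve_length g a b)%E.
Proof.
by move=> /(curve_length_ge_mdist g); apply: le_trans; rewrite lee_fin mdist_ge0.
Qed.

(** Partitions of the two intervals concatenate. The infinite case is split off so that lengths can
    be subtracted. *)
Lemma curve_length_superadd g a b c : a <= b -> b <= c ->
  (curve_length g a b + curve_length g b c <= curve_length g a c)%E.
Proof.
move=> ab bc.
have [->|oo] := eqVneq (curve_length g a c) +oo%E; first by rewrite leey.
have add (s t : seq R) : itv_partition a b s -> itv_partition b c t ->
    ((polygonal_length g a s + polygonal_length g b t)%:E <=
      curve_length g a c)%E.
  move=> abs bct; apply: ereal_sup_ubound; exists (s ++ t).
    exact: itv_partition_cat abs bct.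
  by case: abs => _ /eqP lab; rewrite polygonal_length_cat lab.
have acf : curve_length g a c \is a fin_num.
  rewrite ge0_fin_numE ?ltey//; apply: curve_length_ge0; exact: le_trans bc.
have nonempty (x y : R) : x <= y -> itv_partition x y !=set0.
  rewrite le_eqVlt => /predU1P[<-|xy]; first by exists [::]; split.
  by exists [:: y]; exact: itv_partition1.
(* The two suprema are taken one after the other: over s with t fixed, then over t. *)
have H (t : seq R) : itv_partition b c t ->
    (curve_length g a b <= curve_length g a c - (polygonal_length g b t)%:E)%E.
  move=> bct; apply: ub_ereal_sup => _ [s abs <-].
  by rewrite leeBrDr// -EFinD; exact: add.
have abf : curve_length g a b \is a fin_num.
  rewrite ge0_fin_numE; last exact: curve_length_ge0.
  have [t bct] := nonempty b c bc.
  by apply: le_lt_trans (H _ bct) _; rewrite -(fineK acf) -EFinB ltey.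
rewrite addeC -leeBrDr//; apply: ub_ereal_sup => _ [t bct <-].
by rewrite leeBrDr// addeC -leeBrDr//; exact: H.
Qed.

Lemma rectifiable_sub g a b u v : a <= u -> u <= v -> v <= b ->
  rectifiable_on g a b -> rectifiable_on g u v.
Proof.
rewrite /rectifiable_on => au uv vb; apply: le_lt_trans.
have av := le_trans au uv.
apply: le_trans (curve_length_superadd g av vb).
apply: le_trans (leeD (curve_length_superadd g au uv) (lexx _)).
by rewrite -[leLHS]adde0 leeD ?curve_length_ge0// leeDr ?curve_length_ge0.
Qed.

Lemma curve_lengthE g a b u v : a <= u -> u <= v -> v <= b ->
  rectifiable_on g a b -> curve_length g u v = (len g u v)%:E.
Proof.
move=> au uv vb /(rectifiable_sub au uv vb) r; rewrite /len fineK//.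
by rewrite ge0_fin_numE ?curve_length_ge0.
Qed.

Lemma mdist_len g a b u v : a <= u -> u <= v -> v <= b ->
  rectifiable_on g a b -> mdist (g u) (g v) <= len g u v.
Proof.
move=> au uv vb r; rewrite -lee_fin -(curve_lengthE au uv vb r).
exact: curve_length_ge_mdist.
Qed.

Lemma len_ge0 g a b u v : a <= u -> u <= v -> v <= b ->
  rectifiable_on g a b -> 0 <= len g u v.
Proof.
by move=> au uv vb r; exact: le_trans (mdist_ge0 _ _) (mdist_len au uv vb r).
Qed.

(** The source of upper bounds on length: a potential F whose increments dominate distances. Gluing,
    reparametrization and continuity differ only in the choice of F. *)
Lemma len_le g (F : R -> R) a b : a <= b ->
  (forall u v, a <= u -> u <= v -> v <= b -> mdist (g u) (g v) <= F v - F u) ->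
  rectifiable_on g a b /\ len g a b <= F b - F a.
Proof.
move=> ab /curve_length_le H.
have r : rectifiable_on g a b by exact: le_lt_trans H (ltey _).
by split=> //; rewrite -lee_fin -(curve_lengthE (lexx a) ab (lexx b) r).
Qed.

Lemma len_superadd g a b u v w : a <= u -> u <= v -> v <= w -> w <= b ->
  rectifiable_on g a b -> len g u v + len g v w <= len g u w.
Proof.
move=> au uv vw wb r; have := curve_length_superadd g uv vw.
rewrite (curve_lengthE au uv (le_trans vw wb) r).
rewrite (curve_lengthE (le_trans au uv) vw wb r).
by rewrite (curve_lengthE au (le_trans uv vw) wb r) -EFinD lee_fin.
Qed.

Lemma lenD_rectifiable g a b c : a <= b -> b <= c ->
  rectifiable_on g a b -> rectifiable_on g b c ->
  rectifiable_on g a c /\ len g a c = len g a b + len g b c.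
Proof.
move=> ab bc rab rbc; have ac := le_trans ab bc.
(* Length from a, glued at b; a pair u <= b < v is treated by the triangle inequality through
   [g b]. *)
pose F v := if v <= b then len g a v else len g a b + len g b v.
have [||rac lac] := @len_le g F a c => //.
  move=> u v au uv vc; rewrite /F.
  case: (leP v b) => [vb|bv].
    rewrite (le_trans uv vb); have := len_superadd (lexx a) au uv vb rab.
    have := mdist_len au uv vb rab; lra.
  case: (leP u b) => [ub|bu].
    have := metric_triangle (g u) (g b) (g v).
    have := len_superadd (lexx a) au ub (lexx b) rab.
    have := mdist_len au ub (lexx b) rab.
    have := mdist_len (lexx b) (ltW bv) vc rbc; lra.
  have := len_superadd (lexx b) (ltW bu) uv vc rbc.
  have := mdist_len (ltW bu) uv vc rbc; lra.
split=> //; apply/le_anti; rewrite (len_superadd (lexx a) ab bc (lexx c) rac) andbT.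
apply: le_trans lac _; rewrite /F ab.
(* At c the first branch of F applies only if c = b, where the second length vanishes. *)
case: ifPn => [cb|_]; have := len_ge0 (lexx a) (lexx a) ab rab; last by lra.
have -> : c = b by apply/le_anti; rewrite cb.
by have := len_ge0 (lexx b) (lexx b) bc rbc; lra.
Qed.

Lemma lenD g a b u v w : a <= u -> u <= v -> v <= w -> w <= b ->
  rectifiable_on g a b -> len g u w = len g u v + len g v w.
Proof.
move=> au uv vw wb r.
apply: (lenD_rectifiable uv vw _ _).2; apply: rectifiable_sub r => //.
- exact: le_trans wb.
- exact: le_trans uv.
Qed.

Lemma len_self g a b u : a <= u -> u <= b -> rectifiable_on g a b ->
  len g u u = 0.
Proof.
by move=> au ub r; have := lenD au (lexx u) (lexx u) ub r; lra.
Qed.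

End CurveLength.

(** * Continuity of the length function *)

Section Continuity.
Context {R : realType} {T : metricType R}.
Implicit Types (g : R -> T) (F : R -> R) (a b c u v : R).

Definition continuous_on g a b := forall c, a <= c -> c <= b ->
  forall e : R, 0 < e -> exists2 n : R, 0 < n & forall u, a <= u -> u <= b ->
    `|u - c| < n -> mdist (g c) (g u) < e.

Lemma within_continuousP g a b :
  {within `[a, b], continuous g} <-> continuous_on g a b.
Proof.
split.
  move=> /subspace_continuousP gab c ac cb e e0.
  have /gab : `[a, b]%classic c by rewrite /= in_itv /= ac cb.
  move=> /metricType_numDomainType.cvgrPdist_lt /(_ e e0).
  rewrite near_withinE => /nbhs_ballP[n /= n0 H]; exists n => // u au ub uc.
  apply: H; last by rewrite /= in_itv /= au ub.
  by rewrite /ball /= distrC.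
move=> gab; apply/subspace_continuousP => c /=; rewrite in_itv /= => /andP[ac cb].
apply/metricType_numDomainType.cvgrPdist_lt => e e0; have [n n0 H] := gab c ac cb e e0.
rewrite near_withinE; apply/nbhs_ballP; exists n => // u /= uc.
rewrite in_itv /= => /andP[au ub]; apply: H => //.
by rewrite distrC.
Qed.

Lemma real_within_continuous F a b :
  (forall c, a <= c -> c <= b -> forall e : R, 0 < e -> exists2 n : R, 0 < n &
    forall u, a <= u -> u <= b -> `|u - c| < n -> `|F c - F u| < e) ->
  {within `[a, b], continuous F}.
Proof.
move=> Fab; apply/subspace_continuousP => c /=; rewrite in_itv /= => /andP[ac cb].
apply/cvgrPdist_lt => e e0; have [n n0 H] := Fab c ac cb e e0.
rewrite near_withinE; apply/nbhs_ballP; exists n => // u /= uc.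
rewrite in_itv /= => /andP[au ub]; apply: H => //.
by rewrite distrC.
Qed.

Lemma continuous_on_sub g a b u v : a <= u -> v <= b ->
  continuous_on g a b -> continuous_on g u v.
Proof.
move=> au vb gab c uc cv e e0.
have [n n0 H] := gab c (le_trans au uc) (le_trans cv vb) e e0.
exists n => // x ux xv; apply: H; [exact: le_trans ux|exact: le_trans vb].
Qed.

Lemma lipschitz_continuous_on g a b (C : R) :
  (forall u v, a <= u -> u <= v -> v <= b -> mdist (g u) (g v) <= C * (v - u)) ->
  continuous_on g a b.
Proof.
move=> H c ac cb e e0; pose D := `|C| + 1.
have D0 : 0 < D by rewrite ltr_wpDl.
exists (e / D); first by rewrite divr_gt0.
move=> u au ub; rewrite ltr_pdivlMr// => uc.
have CD : C <= D by rewrite /D (le_trans (ler_norm C))// lerDl.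
have [cu|uc'] := leP c u.
  apply: le_lt_trans (H c u ac cu ub) _; apply: le_lt_trans uc.
  rewrite (ger0_norm (_ : 0 <= u - c)) ?subr_ge0// [leRHS]mulrC.
  by apply: ler_wpM2r; rewrite ?subr_ge0.
rewrite metric_sym; apply: le_lt_trans (H u c au (ltW uc') cb) _.
apply: le_lt_trans uc; rewrite distrC (gtr0_norm (_ : 0 < c - u)) ?subr_gt0//.
by rewrite [leRHS]mulrC; apply: ler_wpM2r => //; lra.
Qed.

(* If the length function jumped by e at c, then subtracting e after c would
   still bound the distances, contradicting the minimality of the length. *)
Lemma len_left_continuous g a b c (e : R) : a < c -> c <= b ->
  continuous_on g a b -> rectifiable_on g a b -> 0 < e ->
  exists2 n : R, 0 < n &
    forall u, a <= u -> c - n < u -> u <= c -> len g u c < e.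
Proof.
move=> ac cb gab r e0.
suff [u [au uc lu]] : exists u, [/\ a <= u, u < c & len g u c < e].
  exists (c - u) => [|v av uv vc]; first by rewrite subr_gt0.
  have uv' : u <= v by lra.
  have := lenD au uv' vc cb r.
  have := len_ge0 au uv' (le_trans vc cb) r; lra.
apply: contrapT => /forallNP H.
have {}H u : a <= u -> u < c -> e <= len g u c.
  by move=> au uc; rewrite leNgt; apply/negP => ?; apply: (H u).
pose F v := if v < c then len g a v else len g a v - e.
have rac := rectifiable_sub (lexx a) (ltW ac) cb r.
have [|_] := @len_le _ _ g F a c (ltW ac).
  move=> u v au uv vc; rewrite /F.
  move: vc uv; rewrite le_eqVlt => /predU1P[->|vc] uv; last first.
    rewrite vc (le_lt_trans uv vc) (lenD (lexx a) au uv (ltW vc) rac).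
    by rewrite addrAC subrr add0r (mdist_len au uv (ltW vc) rac).
  rewrite ltxx; case: ifPn => [uc|]; last first.
    rewrite -leNgt => cu; have -> : u = c by lra.
    by rewrite mdistxx subrr.
  (* Here v = c. For m < c close to c the step from m to c is shorter than e', and the way from u to
     m costs at most [len g u c - e], because at least e of length lies beyond m. *)
  apply/ler_addgt0Pr => e' e'0.
  have [n n0 Hn] := gab c (ltW ac) cb e' e'0.
  pose m := Num.max u (c - n / 2).
  have mc : m < c by rewrite gt_max uc /=; lra.
  have um : u <= m by rewrite le_max lexx.
  have cm : c - n / 2 <= m by rewrite le_max lexx orbT.
  have am := le_trans au um.
  have := Hn m am (le_trans (ltW mc) cb).
  rewrite distrC gtr0_norm ?subr_gt0// => /(_ ltac:(lra)); rewrite metric_sym => gm.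
  have := metric_triangle (g u) (g m) (g c).
  have := mdist_len au um (ltW mc) rac.
  have := H m am mc.
  have := lenD (lexx a) am (ltW mc) (lexx c) rac.
  have := lenD (lexx a) au um (ltW mc) rac.
  lra.
rewrite /F ltxx ac (len_self (lexx a) (ltW ac) rac); lra.
Qed.

(** Mirror image of the left case: the potential loses e immediately after c. *)
Lemma len_right_continuous g a b c (e : R) : a <= c -> c < b ->
  continuous_on g a b -> rectifiable_on g a b -> 0 < e ->
  exists2 n : R, 0 < n &
    forall u, c <= u -> u < c + n -> u <= b -> len g c u < e.
Proof.
move=> ac cb gab r e0.
suff [u [cu ub lu]] : exists u, [/\ c < u, u <= b & len g c u < e].
  exists (u - c) => [|v cv vu vb]; first by rewrite subr_gt0.
  have vu' : v <= u by lra.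
  have := lenD ac cv vu' ub r.
  have := len_ge0 (le_trans ac cv) vu' ub r; lra.
apply: contrapT => /forallNP H.
have {}H u : c < u -> u <= b -> e <= len g c u.
  by move=> cu ub; rewrite leNgt; apply/negP => ?; apply: (H u).
pose F v := if v <= c then 0 else len g c v - e.
have rcb := rectifiable_sub ac (ltW cb) (lexx b) r.
have [|_] := @len_le _ _ g F c b (ltW cb).
  move=> u v cu uv vb; rewrite /F.
  move: cu uv; rewrite le_eqVlt => /predU1P[<-|cu] uv; last first.
    rewrite (leNgt u c) (leNgt v c) cu (lt_le_trans cu uv) /=.
    rewrite (lenD (lexx c) (ltW cu) uv vb rcb).
    have := mdist_len (ltW cu) uv vb rcb; lra.
  rewrite lexx; case: (leP v c) => [vc|cv].
    have -> : v = c by lra.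
    by rewrite mdistxx subrr.
  apply/ler_addgt0Pr => e' e'0.
  have [n n0 Hn] := gab c ac (ltW cb) e' e'0.
  pose m := Num.min v (c + n / 2).
  have cm : c < m by rewrite lt_min cv /=; lra.
  have mv : m <= v by rewrite ge_min lexx.
  have mn : m <= c + n / 2 by rewrite ge_min lexx orbT.
  have mb := le_trans mv vb.
  have := Hn m (le_trans ac (ltW cm)) mb.
  rewrite gtr0_norm ?subr_gt0// => /(_ ltac:(lra)) gm.
  have := metric_triangle (g c) (g m) (g v).
  have := mdist_len (ltW cm) mv vb rcb.
  have := H m cm mb.
  have := lenD (lexx c) (ltW cm) mv vb rcb.
  lra.
rewrite /F lexx (leNgt b c) cb /=; lra.
Qed.

Lemma len_continuous g a b c (e : R) : a <= c -> c <= b ->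
  continuous_on g a b -> rectifiable_on g a b -> 0 < e ->
  exists2 n : R, 0 < n & forall u v, a <= u -> u <= c -> c <= v -> v <= b ->
    c - n < u -> v < c + n -> len g u v < e.
Proof.
move=> ac cb gab r e0; have e20 : 0 < e / 2 by lra.
have [n n0 Hn] : exists2 n : R, 0 < n &
    forall u, a <= u -> c - n < u -> u <= c -> len g u c < e / 2.
  move: ac; rewrite le_eqVlt => /predU1P[ac|ac]; last first.
    exact: (len_left_continuous ac cb gab r e20).
  exists 1 => // u au _ uc; have -> : u = c by lra.
  by rewrite (len_self _ cb r) ?ac.
have [m m0 Hm] : exists2 n : R, 0 < n &
    forall u, c <= u -> u < c + n -> u <= b -> len g c u < e / 2.
  move: cb; rewrite le_eqVlt => /predU1P[cb|cb]; last first.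
    exact: (len_right_continuous ac cb gab r e20).
  exists 1 => // u cu _ ub; have -> : u = c by lra.
  by rewrite (len_self ac _ r) ?cb.
exists (Num.min n m) => [|u v au uc cv vb]; first by rewrite lt_min n0.
move=> cu vc.
have nm1 : Num.min n m <= n by rewrite ge_min lexx.
have nm2 : Num.min n m <= m by rewrite ge_min lexx orbT.
rewrite (lenD au uc cv vb r).
have := Hn u au ltac:(lra) uc; have := Hm v cv ltac:(lra) vb; lra.
Qed.

Lemma len_surj g a b (t : R) : a <= b -> continuous_on g a b ->
  rectifiable_on g a b -> 0 <= t -> t <= len g a b ->
  exists u, [/\ a <= u, u <= b & len g a u = t].
Proof.
move=> ab gab r t0 tl.
have [||u] := @IVT R (len g a) a b t ab.
- apply: real_within_continuous => c ac cb e e0.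
  have [n n0 H] := len_continuous ac cb gab r e0.
  exists n => // u au ub; rewrite ltr_distl => /andP[cu uc].
  have [cu'|uc'] := leP c u.
    have := H c u ac (lexx c) cu' ub ltac:(lra) uc.
    have := len_ge0 ac cu' ub r.
    rewrite (lenD (lexx a) ac cu' ub r) ltr_norml; lra.
  have := H u c au (ltW uc') (lexx c) cb cu ltac:(lra).
  have := len_ge0 au (ltW uc') cb r.
  rewrite (lenD (lexx a) au (ltW uc') cb r) ltr_norml; lra.
- rewrite (len_self (lexx a) ab r) min_l ?max_r ?(le_trans t0)//; lra.
- by rewrite in_itv /= => /andP[au ub] <-; exists u.
Qed.

End Continuity.

(** * Invariance of length under monotone changes of parameter and reversal *)

Section Reparametrization.
Context {R : realType} {T : metricType R}.
Implicit Types (g : R -> T) (phi : R -> R) (a b c u v : R).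

(** Only weakly monotone, because the length function of a curve is constant where the curve stands
    still. Surjectivity stands in for continuity. *)
Definition monotone_onto phi a b :=
  (forall u v, a <= u -> u <= v -> v <= b -> phi u <= phi v) /\
  (forall y, phi a <= y -> y <= phi b ->
    exists u, [/\ a <= u, u <= b & phi u = y]).

Lemma monotone_onto_sub phi a b u v : a <= u -> u <= v -> v <= b ->
  monotone_onto phi a b -> monotone_onto phi u v.
Proof.
move=> au uv vb [mono onto]; split=> [x y ux xy yv|y uy yv].
  by apply: mono => //; [exact: le_trans ux|exact: le_trans vb].
have ub := le_trans uv vb; have av := le_trans au uv.
have [||x [ax xb xy]] := onto y.
- by apply: le_trans uy; exact: mono.
- by apply: (le_trans yv); exact: mono.
(* The preimage x of y may lie outside [u, v]; by monotonicity y is then the value at an end. *)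
have [ux|xu] := leP u x; last first.
  exists u; split=> //; apply/le_anti; rewrite uy -xy.
  by apply: mono => //; exact: ltW.
have [xv|vx] := leP x v; first by exists x.
exists v; split=> //; apply/le_anti; rewrite yv -xy andbT.
by apply: mono => //; exact: ltW.
Qed.

Lemma len_reparam_le g g' phi a b : a <= b ->
  (forall u, a <= u -> u <= b -> g u = g' (phi u)) -> monotone_onto phi a b ->
  rectifiable_on g' (phi a) (phi b) ->
  rectifiable_on g a b /\ len g a b <= len g' (phi a) (phi b).
Proof.
move=> ab gg' [mono onto] r'.
have [|r l] := @len_le _ _ g (fun v => len g' (phi a) (phi v)) a b ab.
- move=> u v au uv vb; rewrite !gg' ?(le_trans au uv) ?(le_trans uv vb)//.
  have pau : phi a <= phi u by apply: mono => //; exact: le_trans vb.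
  have puv := mono _ _ au uv vb.
  have pvb : phi v <= phi b by apply: mono => //; exact: le_trans uv.
  rewrite (lenD (lexx _) pau puv pvb r').
  have := mdist_len pau puv pvb r'; lra.
- split=> //; apply: le_trans l _.
  by rewrite (len_self (lexx _) _ r') ?subr0//; apply: mono.
Qed.

(** Since [phi] may be constant on intervals, it is inverted by a section [psi], monotone because
    [phi] is. The length of g up to [psi y] is the potential for g'. *)
Lemma len_reparam_ge g g' phi a b : a <= b ->
  (forall u, a <= u -> u <= b -> g u = g' (phi u)) -> monotone_onto phi a b ->
  rectifiable_on g a b ->
  rectifiable_on g' (phi a) (phi b) /\ len g' (phi a) (phi b) <= len g a b.
Proof.
move=> ab gg' [mono onto] r.
have pab : phi a <= phi b by apply: mono.
pose psi y := xget a [set u | [/\ a <= u, u <= b & phi u = y]].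
have psiP y : phi a <= y -> y <= phi b ->
    [/\ a <= psi y, psi y <= b & phi (psi y) = y].
  by move=> ay yb; have /(xgetPex a) := onto y ay yb.
have [|r' l] := @len_le _ _ g' (fun y => len g a (psi y)) _ _ pab.
- move=> y z ay yz zb.
  have [ay' yb' ey] := psiP y ay (le_trans yz zb).
  have [az' zb' ez] := psiP z (le_trans ay yz) zb.
  have -> : g' y = g (psi y) by rewrite gg' ?ey.
  have -> : g' z = g (psi z) by rewrite gg' ?ez.
  move: yz; rewrite le_eqVlt => /predU1P[->|yz].
    by rewrite mdistxx subrr.
  have psi_le : psi y <= psi z.
    rewrite leNgt; apply/negP => zy; have := yz; rewrite ltNge => /negP; apply.
    rewrite -ez -ey.
    by apply: mono => //; exact: ltW.
  rewrite (lenD (lexx a) ay' psi_le zb' r).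
  have := mdist_len ay' psi_le zb' r; lra.
- split=> //; apply: le_trans l _.
  have [a1 b1 _] := psiP _ (lexx _) pab; have [a2 b2 _] := psiP _ pab (lexx _).
  have := len_ge0 (lexx a) a1 b1 r; have := len_ge0 a2 b2 (lexx b) r.
  have := lenD (lexx a) a2 b2 (lexx b) r; lra.
Qed.

Lemma len_rev_le g a b c : a <= b ->
  rectifiable_on g (c - b) (c - a) ->
  rectifiable_on (fun u => g (c - u)) a b /\
  len (fun u => g (c - u)) a b <= len g (c - b) (c - a).
Proof.
move=> ab r.
have [|r' l] :=
  @len_le _ _ (fun u => g (c - u)) (fun v => - len g (c - b) (c - v)) a b ab.
- move=> u v au uv vb.
  have h1 : c - b <= c - v by lra.
  have h2 : c - v <= c - u by lra.
  have h3 : c - u <= c - a by lra.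
  rewrite metric_sym (lenD (lexx _) h1 h2 h3 r).
  have := mdist_len h1 h2 h3 r; lra.
- split=> //; apply: le_trans l _.
  by rewrite (len_self (lexx _) _ r); lra.
Qed.

End Reparametrization.

(** * Quasihyperbolic length *)

Section Weights.
Context {R : realType} {T : metricType R}.
Variable X : set T.
Hypotheses (oX : open X) (bX : boundary X !=set0).
Implicit Types (g : R -> T) (F phi : R -> R) (a b c u v : R).

Lemma dist_boundary_lipschitz p q :
  dist_boundary X p <= dist_boundary X q + mdist p q.
Proof.
have lb x : has_inf [set mdist x z | z in boundary X].
  split; first by have [z bz] := bX; exists (mdist x z), z.
  by exists 0 => _ [z _ <-]; exact: mdist_ge0.
rewrite -lerBlDr; apply: lb_le_inf; first exact: (lb q).1.
move=> _ [z bz <-]; rewrite lerBlDr.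
apply: (@le_trans _ _ (mdist p z)); last first.
  by rewrite addrC; exact: metric_triangle.
by apply: ge_inf; [exact: (lb p).2|exists z].
Qed.

Lemma dist_boundary_gt0 p : X p -> 0 < dist_boundary X p.
Proof.
move=> Xp; have /nbhs_ballP[e /= e0 eX] : nbhs p X by exact: open_nbhs_nbhs.
apply: (lt_le_trans e0); apply: lb_le_inf.
  by have [z bz] := bX; exists (mdist p z), z.
move=> _ [z [_ niz] <-]; rewrite leNgt; apply/negP => pz; apply: niz.
by apply: open_nbhs_nbhs; split=> //; apply: eX; rewrite ballEmdist.
Qed.

Local Notation f := (fun p => (dist_boundary X p)^-1).

Lemma inv_dist_boundary_continuous p (e : R) : X p -> 0 < e ->
  exists2 n : R, 0 < n & forall q, mdist p q < n -> `|f p - f q| < e.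
Proof.
move=> Xp e0; set D := dist_boundary X p.
have D0 : 0 < D by exact: dist_boundary_gt0.
(* Within D / 2 of p the distance to the boundary exceeds D / 2, so the inverses differ by at most
   [mdist p q / (D * D / 2)]. *)
exists (Num.min (D / 2) (e * (D * D / 2))).
  by rewrite lt_min !(divr_gt0, mulr_gt0).
move=> q; rewrite lt_min => /andP[q1 q2].
have := dist_boundary_lipschitz p q; have := dist_boundary_lipschitz q p.
rewrite (metric_sym q p) -/D; set D' := dist_boundary X q => h1 h2.
have D'D : D / 2 < D' by lra.
have D'0 : 0 < D' by lra.
have -> : D^-1 - D'^-1 = (D' - D) / (D * D') by field; lra.
rewrite normrM normfV (gtr0_norm (mulr_gt0 D0 D'0)) ltr_pdivrMr ?mulr_gt0//.
apply: (@le_lt_trans _ _ (mdist p q)); first by rewrite ler_norml; lra.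
apply: lt_trans q2 _; rewrite ltr_pM2l// -mulrA ltr_pM2l//.
Qed.

Definition curve_in (A : set T) g a b := [/\ a <= b, continuous_on g a b,
  rectifiable_on g a b & forall u, a <= u -> u <= b -> A (g u)].

Lemma curve_in_sub A g a b u v : a <= u -> u <= v -> v <= b ->
  curve_in A g a b -> curve_in A g u v.
Proof.
move=> au uv vb [ab cg rg gA]; split=> //.
- exact: continuous_on_sub cg.
- exact: rectifiable_sub rg.
- by move=> s us sv; apply: gA; [exact: le_trans us|exact: le_trans vb].
Qed.

Lemma inv_dist_boundary_curve_continuous g a b c (e : R) : curve_in X g a b ->
  a <= c -> c <= b -> 0 < e -> exists2 n : R, 0 < n &
  forall u, a <= u -> u <= b -> `|u - c| < n -> `|f (g c) - f (g u)| < e.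
Proof.
move=> [ab cg _ gX] ac cb e0.
have [n n0 H] := inv_dist_boundary_continuous (gX c ac cb) e0.
have [m m0 H'] := cg c ac cb n n0.
by exists m => // u au ub uc; apply: H; exact: H'.
Qed.

(* F is a primitive of the arc length element weighted by the inverse distance
   to the boundary. *)
Definition weight_on g F a b := forall u v (m M : R),
  a <= u -> u <= v -> v <= b ->
  (forall s, u <= s -> s <= v -> m <= f (g s) /\ f (g s) <= M) ->
  m * len g u v <= F v - F u /\ F v - F u <= M * len g u v.

(** On a short interval the integrand oscillates by at most e, so the increments of F and F' differ
    by at most e times the length. This estimate is additive, and interval induction makes it
    global. *)
Lemma weight_on_unique g F F' a b : curve_in X g a b ->
  weight_on g F a b -> weight_on g F' a b -> F b - F a = F' b - F' a.
Proof.
move=> gab wF wF'; have [ab cg rg gX] := gab.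
suff H (e : R) : 0 < e -> `|(F b - F a) - (F' b - F' a)| <= e * len g a b.
  apply/eqP; rewrite -subr_eq0 -normr_eq0 eq_le normr_ge0 andbT.
  have l0 := len_ge0 (lexx a) ab (lexx b) rg.
  apply/ler_addgt0Pr => e e0; rewrite add0r.
  have := H (e / (len g a b + 1)); rewrite divr_gt0 ?ltr_wpDl// => /(_ isT).
  move/le_trans; apply; rewrite mulrAC ler_pdivrMr ?ltr_wpDl//.
  by rewrite mulrDr mulr1 lerDl ltW.
move=> e0.
pose E s t := `|(F t - F s) - (F' t - F' s)| <= e * len g s t.
apply: (@interval_induction _ E) => // [s m t as_ sm mt tb|c ac cb].
  rewrite /E (lenD as_ sm mt tb rg) mulrDr !ler_norml; lra.
have e20 : 0 < e / 2 by lra.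
have [n n0 H] := inv_dist_boundary_curve_continuous gab ac cb e20.
exists n => // s t as_ sc ct tb cs tc.
have K x : s <= x -> x <= t ->
    f (g c) - e / 2 <= f (g x) /\ f (g x) <= f (g c) + e / 2.
  move=> sx xt; have := H x (le_trans as_ sx) (le_trans xt tb).
  have : `|x - c| < n by rewrite ltr_norml; lra.
  move=> xn /(_ xn); rewrite ltr_norml; lra.
have := wF s t _ _ as_ (le_trans sc ct) tb K.
have := wF' s t _ _ as_ (le_trans sc ct) tb K.
rewrite /E ler_norml; nra.
Qed.

Lemma arclength_paramE g a b u : curve_in X g a b -> a <= u -> u <= b ->
  arclength_param g a b (len g a u) = g u.
Proof.
move=> [ab cg rg gX] au ub; rewrite /arclength_param.
have : exists v, [set v | v \in `[a, b] /\ curve_length g a v = (len g a u)%:E] v.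
  exists u; rewrite /= in_itv /= au ub; split=> //.
  exact: curve_lengthE (lexx a) au ub rg.
move=> /(xgetPex a) /= []; set v := xget _ _.
rewrite in_itv /= => /andP[av vb]; rewrite (curve_lengthE (lexx a) av vb rg).
move=> -[luv]; apply: mdist_positivity; apply/le_anti; rewrite mdist_ge0 andbT.
have [uv|vu] := leP u v.
  rewrite metric_sym; have := mdist_len au uv vb rg.
  have := lenD (lexx a) au uv vb rg; lra.
have := mdist_len av (ltW vu) ub rg.
have := lenD (lexx a) av (ltW vu) ub rg; lra.
Qed.

Lemma arclength_param_surj g a b u v (t : R) : curve_in X g a b ->
  a <= u -> u <= v -> v <= b -> len g a u <= t -> t <= len g a v ->
  exists s, [/\ u <= s, s <= v, t = len g a s & arclength_param g a b t = g s].
Proof.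
move=> gab au uv vb ut tv; have [ab cg rg gX] := gab.
have [_ cguv rguv _] := curve_in_sub au uv vb gab.
have [||s [us sv st]] := @len_surj _ _ g u v (t - len g a u) uv cguv rguv.
- by rewrite subr_ge0.
- by have := lenD (lexx a) au uv vb rg; lra.
have tE : t = len g a s.
  rewrite (lenD (lexx a) au us (le_trans sv vb) rg); lra.
exists s; split=> //; rewrite tE; apply: arclength_paramE => //.
- exact: le_trans us.
- exact: le_trans vb.
Qed.

(** A curve is 1-Lipschitz in its arc length, so the integrand is continuous on a compact
    interval. *)
Lemma integrable_arclength g a b : curve_in X g a b ->
  lebesgue_measure.-integrable `[0, len g a b]
    (EFin \o (f \o arclength_param g a b)).
Proof.
move=> gab; have [ab cg rg gX] := gab.
apply: continuous_compact_integrable; first exact: segment_compact.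
apply: real_within_continuous => t t0 tl e e0.
have laa := len_self (lexx a) ab rg.
have [||s [as_ sb tE gs]] := @arclength_param_surj g a b a b t gab (lexx a) ab (lexx b).
- by rewrite laa.
- by [].
have [n n0 H] := inv_dist_boundary_continuous (gX s as_ sb) e0.
exists n => // t' t'0 t'l tt'.
have [||s' [as' s'b t'E gs']] :=
  @arclength_param_surj g a b a b t' gab (lexx a) ab (lexx b).
- by rewrite laa.
- by [].
rewrite /= gs gs'; apply: H; apply: le_lt_trans tt'.
rewrite tE t'E; have [ss'|s's] := leP s s'.
  apply: le_trans (mdist_len as_ ss' s'b rg) _.
  rewrite (lenD (lexx a) as_ ss' s'b rg) addrAC subrr add0r.
  exact: ler_norm.
rewrite metric_sym; apply: le_trans (mdist_len as' (ltW s's) sb rg) _.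
rewrite (lenD (lexx a) as' (ltW s's) sb rg) opprD addrA subrr add0r normrN.
exact: ler_norm.
Qed.

(* Locked because unification is prone to unfold the integral. *)
Definition qlen : set T -> (R -> T) -> R -> R -> R := locked (@qh_length R T).

Lemma qlenE : @qh_length R T = qlen. Proof. by rewrite /qlen -lock. Qed.

Lemma weight_qlen g a b : curve_in X g a b ->
  weight_on g (qlen X g a) a b.
Proof.
move=> gab u v m M au uv vb fmM; have [ab cg rg gX] := gab.
have laa := len_self (lexx a) ab rg.
pose h t := f (arclength_param g a b t).
(* The arc length parametrizations of [a, x] and [a, b] agree, so the lengths up to different x are
   integrals of one function h, and increments are integrals over intervals. *)
have QE x : a <= x -> x <= b ->
    qlen X g a x = \int[lebesgue_measure]_(t in `[0, len g a x]) h t.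
  move=> ax xb; have gax := curve_in_sub (lexx a) ax xb gab.
  rewrite -qlenE; apply: eq_Rintegral => t; rewrite inE /= in_itv /= => /andP[t0 tx].
  have [||s [as_ sx tE ->]] := @arclength_param_surj g a x a x t gax (lexx a) ax (lexx x).
  - by rewrite laa.
  - by [].
  by rewrite /h tE (arclength_paramE gab)// (le_trans sx).
have lu0 := len_ge0 (lexx a) au (le_trans uv vb) rg.
have luv : len g a u <= len g a v.
  by rewrite (lenD (lexx a) au uv vb rg) lerDl (len_ge0 au uv vb rg).
have lvb : len g a v <= len g a b.
  rewrite (lenD (lexx a) (le_trans au uv) vb (lexx b) rg) lerDl.
  exact: len_ge0 (le_trans au uv) vb (lexx b) rg.
have hint : lebesgue_measure.-integrable `[0, len g a v] (EFin \o h).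
  apply: integrableS (integrable_arclength gab) => //.
  by apply: subset_itvl; rewrite bnd_simp.
rewrite (QE v) ?(le_trans au uv)// (QE u) ?(le_trans uv vb)//.
rewrite Rintegral_itvB ?bnd_simp//.
have -> : len g u v = fine (lebesgue_measure `]len g a u, len g a v]).
  rewrite lebesgue_measure_itv /= lte_fin.
  rewrite (lenD (lexx a) au uv vb rg); case: ltP => /= h0.
    by rewrite addrAC subrr add0r.
  by have := len_ge0 au uv vb rg; lra.
have hint' : lebesgue_measure.-integrable `]len g a u, len g a v] (EFin \o h).
  apply: integrableS hint => //.
  by apply: subset_itvr; rewrite bnd_simp.
have cint (k : R) : lebesgue_measure.-integrable `]len g a u, len g a v]
    (EFin \o (fun=> k)).
  apply: integrableS (_ : lebesgue_measure.-integrable `[len g a u, len g a v] _) => //.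
    by apply: subset_itvr; rewrite bnd_simp.
  apply: continuous_compact_integrable; first exact: segment_compact.
  by move=> ?; exact: cvg_cst.
have hP t : `]len g a u, len g a v]%classic t -> m <= h t /\ h t <= M.
  rewrite /= in_itv /= => /andP[ut tv].
  have [s [us sv _ gs]] := arclength_param_surj gab au uv vb (ltW ut) tv.
  by rewrite /h gs; exact: fmM.
split.
- rewrite -Rintegral_cst//; apply: le_Rintegral => // t /hP[]//.
- rewrite -Rintegral_cst//; apply: le_Rintegral => // t /hP[]//.
Qed.

Lemma qlen_self g a : rectifiable_on g a a -> qlen X g a a = 0.
Proof.
move=> r; rewrite -qlenE /qh_length /curve_integral -/(len g a a).
by rewrite (len_self (lexx a) (lexx a) r) set_itv1 Rintegral_set1.
Qed.

Lemma qlen_ge0 g a b : curve_in X g a b -> 0 <= qlen X g a b.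
Proof.
move=> [ab _ _ _]; rewrite -qlenE; apply: Rintegral_ge0 => t _.
rewrite invr_ge0; apply: lb_le_inf => [|_ [z _ <-]]; last exact: mdist_ge0.
by have [z bz] := bX; exists (mdist (arclength_param g a b t) z), z.
Qed.

(** On [b, c] the lengths counted from a and from b are both weights, so they have the same
    increments. *)
Lemma qlenD g a b c : a <= b -> b <= c -> curve_in X g a c ->
  qlen X g a c = qlen X g a b + qlen X g b c.
Proof.
move=> ab bc gac; have gbc := curve_in_sub ab bc (lexx c) gac.
have [_ _ rbc _] := gbc.
have rbb := rectifiable_sub (lexx b) (lexx b) bc rbc.
have wac : weight_on g (qlen X g a) b c.
  move=> u v m M bu uv vc; apply: (weight_qlen gac) => //.
  exact: le_trans bu.
have := weight_on_unique gbc wac (weight_qlen gbc).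
have := qlen_self rbb; lra.
Qed.

Lemma qlen_bounds g a b (m M : R) : curve_in X g a b ->
  (forall s, a <= s -> s <= b -> m <= f (g s) /\ f (g s) <= M) ->
  m * len g a b <= qlen X g a b /\ qlen X g a b <= M * len g a b.
Proof.
move=> gab H; have [ab _ r _] := gab.
have := weight_qlen gab (lexx a) ab (lexx b) H.
rewrite qlen_self ?subr0//.
exact: rectifiable_sub r.
Qed.

(** The length of g' up to [phi u] is a weight for g, because [phi] preserves arc length and points.
    Uniqueness of weights replaces a change of variables in the integral. *)
Lemma qlen_reparam g g' phi a b :
  (forall u, a <= u -> u <= b -> g u = g' (phi u)) -> monotone_onto phi a b ->
  curve_in X g a b -> curve_in X g' (phi a) (phi b) ->
  qlen X g a b = qlen X g' (phi a) (phi b).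
Proof.
move=> gg' phi_ab gab g'ab; have [ab _ rg _] := gab; have [_ _ rg' _] := g'ab.
have raa := rectifiable_sub (lexx a) (lexx a) ab rg.
have pab : phi a <= phi b by apply phi_ab.1.
have raa' := rectifiable_sub (lexx _) (lexx _) pab rg'.
have := weight_on_unique gab (weight_qlen gab).
rewrite qlen_self// subr0 => /(_ (fun u => qlen X g' (phi a) (phi u))) ->.
  by rewrite /= qlen_self// subr0.
move=> u v m M au uv vb H.
have pau : phi a <= phi u by apply phi_ab.1 => //; exact: le_trans vb.
have puv : phi u <= phi v by apply phi_ab.1.
have pvb : phi v <= phi b by apply phi_ab.1 => //; exact: le_trans uv.
have g'uv := curve_in_sub pau puv pvb g'ab.
have [_ _ rg'uv _] := g'uv.
rewrite (qlenD pau puv (curve_in_sub (lexx _) (le_trans pau puv) pvb g'ab)).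
rewrite addrAC subrr add0r.
have phi_uv := monotone_onto_sub au uv vb phi_ab.
have gg'uv s : u <= s -> s <= v -> g s = g' (phi s).
  by move=> us sv; apply: gg'; [exact: le_trans us|exact: le_trans vb].
have ruv := rectifiable_sub au uv vb rg.
have -> : len g u v = len g' (phi u) (phi v).
  apply/le_anti; rewrite (len_reparam_le uv gg'uv phi_uv rg'uv).2.
  exact: (len_reparam_ge uv gg'uv phi_uv ruv).2.
apply: qlen_bounds => // y uy yv.
have [s [us sv <-]] := phi_uv.2 y uy yv.
by rewrite -gg'uv//; exact: H.
Qed.

End Weights.

(** * Operations on curves and parametrization by quasihyperbolic length *)

Section QuasihyperbolicLength.
Context {R : realType} {T : metricType R}.
Variable X : set T.
Hypotheses (oX : open X) (bX : boundary X !=set0).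
Implicit Types (A : set T) (g : R -> T) (phi : R -> R) (a b c u v : R).

Local Notation f := (fun p => (dist_boundary X p)^-1).

Lemma curve_in_subset A B g a b : A `<=` B -> curve_in A g a b ->
  curve_in B g a b.
Proof. by move=> AB [ab cg rg gA]; split=> // u au ub; apply/AB/gA. Qed.

Lemma continuous_on_comp g g' phi a b (K : R) :
  (forall u, a <= u -> u <= b -> g u = g' (phi u)) ->
  (forall u v, a <= u -> u <= v -> v <= b -> phi u <= phi v) ->
  (forall u v, a <= u -> u <= v -> v <= b -> phi v - phi u <= K * (v - u)) ->
  continuous_on g' (phi a) (phi b) -> continuous_on g a b.
Proof.
move=> gg' mono lip cg' c ac cb e e0.
have [||n n0 H] := cg' (phi c) _ _ e e0; [exact: mono|exact: mono|].
pose D := `|K| + 1; have D0 : 0 < D by rewrite ltr_wpDl.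
have KD : K <= D by rewrite /D (le_trans (ler_norm K))// lerDl.
exists (n / D) => [|u au ub]; first by rewrite divr_gt0.
rewrite ltr_pdivlMr// => uc; rewrite !gg'//.
have ab := le_trans ac cb.
apply: H; [exact: mono|exact: mono|apply: le_lt_trans uc].
have [cu|uc'] := leP c u.
  have := mono c u ac cu ub; have := lip c u ac cu ub.
  have -> : `|u - c| = u - c by rewrite ger0_norm ?subr_ge0.
  by rewrite ler_norml; nra.
have := mono u c au (ltW uc') cb; have := lip u c au (ltW uc') cb.
have -> : `|u - c| = c - u by rewrite distrC gtr0_norm ?subr_gt0.
by rewrite ler_norml; nra.
Qed.

Lemma curve_in_comp A g g' phi a b (K : R) : a <= b ->
  (forall u, a <= u -> u <= b -> g u = g' (phi u)) ->
  (forall u v, a <= u -> u <= v -> v <= b -> phi v - phi u <= K * (v - u)) ->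
  monotone_onto phi a b -> curve_in A g' (phi a) (phi b) -> curve_in A g a b.
Proof.
move=> ab gg' lip phi_ab [pab cg' rg' g'A]; split=> //.
- by apply: continuous_on_comp gg' _ lip cg'; exact: phi_ab.1.
- exact: (len_reparam_le ab gg' phi_ab rg').1.
- by move=> u au ub; rewrite gg'//; apply: g'A; apply phi_ab.1.
Qed.

Lemma affine_monotone_onto (k m : R) a b : 0 < k ->
  monotone_onto (fun t => k * t + m) a b.
Proof.
move=> k0; split=> [u v _ uv _|y ay yb]; first by nra.
have e : k * ((y - m) / k) = y - m by rewrite mulrC divfK// gt_eqF.
exists ((y - m) / k); rewrite e subrK; split=> //.
- by rewrite ler_pdivlMr//; lra.
- by rewrite ler_pdivrMr//; lra.
Qed.

Lemma curve_in_affine A g (k m : R) a b : 0 < k -> A `<=` X -> a <= b ->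
  curve_in A g (k * a + m) (k * b + m) ->
  curve_in A (fun t => g (k * t + m)) a b /\
  qlen X (fun t => g (k * t + m)) a b = qlen X g (k * a + m) (k * b + m).
Proof.
move=> k0 AX ab gA.
have onto := affine_monotone_onto m a b k0.
have cA : curve_in A (fun t => g (k * t + m)) a b.
  apply: (@curve_in_comp A _ g (fun t => k * t + m) a b k) => // u v _ _ _.
  lra.
split=> //.
exact: (qlen_reparam oX bX (phi := fun t => k * t + m) _ onto
          (curve_in_subset AX cA) (curve_in_subset AX gA)).
Qed.

Lemma curve_in_ext A g g' a b : A `<=` X ->
  (forall u, a <= u -> u <= b -> g u = g' u) -> curve_in A g' a b ->
  curve_in A g a b /\ qlen X g a b = qlen X g' a b.
Proof.
move=> AX gg' g'A; have [ab _ _ _] := g'A.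
have onto : monotone_onto id a b by split=> // y ay yb; exists y.
have gA : curve_in A g a b.
  by apply: (@curve_in_comp A _ g' id a b 1) => // u v _ _ _; rewrite mul1r.
split=> //; exact: (qlen_reparam oX bX (phi := id) gg' onto
  (curve_in_subset AX gA) (curve_in_subset AX g'A)).
Qed.

Lemma continuous_on_rev g a b c : continuous_on g (c - b) (c - a) ->
  continuous_on (fun u => g (c - u)) a b.
Proof.
move=> cg x ax xb e e0; have [||n n0 H] := cg (c - x) _ _ e e0; [lra|lra|].
exists n => // u au ub ux; apply: H; [lra|lra|].
have -> : c - u - (c - x) = x - u by ring.
by rewrite distrC.
Qed.

(** A reversal is not monotone and gets its own weight: minus the length that remains to be
    covered. *)
Lemma curve_in_rev A g a b c : A `<=` X -> curve_in A g (c - b) (c - a) ->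
  curve_in A (fun u => g (c - u)) a b /\
  qlen X (fun u => g (c - u)) a b = qlen X g (c - b) (c - a).
Proof.
move=> AX gA; have [ab' cg rg gA'] := gA; have ab : a <= b by lra.
have [rr _] := len_rev_le ab rg.
have grA : curve_in A (fun u => g (c - u)) a b.
  split=> //; first exact: continuous_on_rev.
  by move=> u au ub; apply: gA'; lra.
have grX := curve_in_subset AX grA; have gX := curve_in_subset AX gA.
split=> //.
have w : weight_on X (fun u => g (c - u)) (fun u => - qlen X g (c - b) (c - u)) a b.
  move=> u v m M au uv vb H.
  have h1 : c - b <= c - v by lra.
  have h2 : c - v <= c - u by lra.
  have h3 : c - u <= c - a by lra.
  have ruv := rectifiable_sub h1 h2 h3 rg.
  have rruv := rectifiable_sub au uv vb rr.
  have -> : len (fun x => g (c - x)) u v = len g (c - v) (c - u).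
    apply/le_anti; rewrite (len_rev_le uv ruv).2 /=.
    (* Reversing twice gives back g, hence the opposite inequality. *)
    have := @len_rev_le _ _ (fun x => g (c - x)) (c - v) (c - u) c h2.
    rewrite !subKr => /(_ rruv) [_].
    by rewrite (_ : (fun x => g (c - (c - x))) = g)//; apply/funext => x; rewrite subKr.
  have := qlenD oX bX h1 h2 (curve_in_sub (lexx _) (le_trans h1 h2) h3 gX).
  have := qlen_bounds oX bX (m := m) (M := M) (curve_in_sub h1 h2 h3 gX).
  case=> [s s1 s2|]; last by lra.
  by have := H (c - s); rewrite subKr; apply; lra.
have := weight_on_unique oX bX grX (weight_qlen oX bX grX) w.
have := qlen_self X (rectifiable_sub (lexx a) (lexx a) ab rr).
have := qlen_self X (rectifiable_sub (lexx _) (lexx (c - b)) ab' rg).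
lra.
Qed.

Lemma continuous_on_cat g a b c : a <= b -> b <= c -> continuous_on g a b ->
  continuous_on g b c -> continuous_on g a c.
Proof.
move=> ab bc gab gbc x ax xc e e0.
have [xb|bx|xb] := ltgtP x b.
- have [n n0 H] := gab x ax (ltW xb) e e0.
  exists (Num.min n (b - x)) => [|u au uc]; first by rewrite lt_min n0 subr_gt0.
  rewrite lt_min => /andP[un]; rewrite ltr_norml => /andP[_ ub].
  by apply: H => //; lra.
- have [n n0 H] := gbc x (ltW bx) xc e e0.
  exists (Num.min n (x - b)) => [|u au uc]; first by rewrite lt_min n0 subr_gt0.
  rewrite lt_min => /andP[un]; rewrite ltr_norml => /andP[ub _].
  by apply: H => //; lra.
- rewrite xb.
  have [n n0 H] := gab b ab (lexx b) e e0.
  have [m m0 H'] := gbc b (lexx b) bc e e0.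
  exists (Num.min n m) => [|u au uc]; first by rewrite lt_min n0.
  rewrite lt_min => /andP[un um].
  by have [ub|bu] := leP u b; [exact: H|apply: H' => //; exact: ltW].
Qed.

Lemma curve_in_cat A g a b c : A `<=` X -> curve_in A g a b ->
  curve_in A g b c -> curve_in A g a c /\
  qlen X g a c = qlen X g a b + qlen X g b c.
Proof.
move=> AX [ab cab rab gab] [bc cbc rbc gbc]; have ac := le_trans ab bc.
have gA : curve_in A g a c.
  split=> //; first exact: continuous_on_cat cab cbc.
  - exact: (lenD_rectifiable ab bc rab rbc).1.
  - move=> u au uc; have [ub|bu] := leP u b; first exact: gab.
    by apply: gbc => //; exact: ltW.
by split=> //; apply: (qlenD oX bX ab bc); exact: curve_in_subset gA.
Qed.

Lemma curve_concat A g g' a b a' b' : A `<=` X -> curve_in A g a b ->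
  curve_in A g' a' b' -> g b = g' a' ->
  exists (g'' : R -> T) c, [/\ curve_in A g'' a c, g'' a = g a, g'' c = g' b' &
    qlen X g'' a c = qlen X g a b + qlen X g' a' b'].
Proof.
move=> AX gA g'A gg'; have [ab _ _ _] := gA; have [ab' _ _ _] := g'A.
pose m := a' - b.
pose g'' t := if t <= b then g t else g' (1 * t + m).
have [h1 q1] : curve_in A g'' a b /\ qlen X g'' a b = qlen X g a b.
  by apply: curve_in_ext => // u au ub; rewrite /g'' ub.
have e1 : 1 * b + m = a' by rewrite /m; ring.
have e2 : 1 * (b' - m) + m = b' by ring.
have bc : b <= b' - m by rewrite /m; lra.
have [h2 q2] : curve_in A g'' b (b' - m) /\
    qlen X g'' b (b' - m) = qlen X g' a' b'.
  have [|k1 k2] := @curve_in_affine A g' 1 m b (b' - m) ltr01 AX bc.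
    by rewrite e1 e2.
  have [|k3 k4] := @curve_in_ext A g'' _ b (b' - m) AX _ k1.
    move=> u bu uc; rewrite /g''; case: leP => // ub.
    have -> : u = b by apply/le_anti; rewrite ub.
    by rewrite e1.
  by split=> //; rewrite k4 k2 e1 e2.
have [h3 q3] := curve_in_cat AX h1 h2.
exists g'', (b' - m); split=> //.
- by rewrite /g'' ab.
- rewrite /g''; case: leP => [cb|_]; last by rewrite e2.
  have e : b' = a' by move: cb; rewrite /m; lra.
  by rewrite e /m subKr gg'.
- by rewrite q3 q1 q2.
Qed.

Lemma inv_dist_boundary_bounded g a b : curve_in X g a b ->
  exists m M : R, [/\ 0 < m, 0 < M & forall s, a <= s -> s <= b ->
    m <= f (g s) /\ f (g s) <= M].
Proof.
move=> gX; have [ab _ _ gX'] := gX.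
have cont : {within `[a, b], continuous (fun t => f (g t))}.
  apply: real_within_continuous => c ac cb e e0.
  exact: (inv_dist_boundary_curve_continuous oX bX gX ac cb e0).
have fpos s : a <= s -> s <= b -> 0 < f (g s).
  by move=> as_ sb; rewrite invr_gt0; apply: dist_boundary_gt0 => //; exact: gX'.
have [c cab cm] := EVT_min ab cont; have [d dab dM] := EVT_max ab cont.
exists (f (g c)), (f (g d)); move: cab dab; rewrite !in_itv /=.
move=> /andP[ac cb] /andP[ad db]; split; [exact: fpos|exact: fpos|].
by move=> s as_ sb; split; [apply: cm|apply: dM]; rewrite in_itv /= as_ sb.
Qed.

Definition qh_param A g (L : R) := curve_in A g 0 L /\
  forall s t : R, 0 <= s -> s <= t -> t <= L -> qlen X g s t = t - s.

(** The length function V is comparable with arc length, so it is continuous and two parameters with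
    the same V give the same point. The new curve is g composed with a section of V. The last clause
    later carries injectivity of g over to [gam]. *)
Lemma qh_param_exists A g a b : A `<=` X -> curve_in A g a b ->
  exists gam : R -> T, [/\ qh_param A gam (qlen X g a b), gam 0 = g a,
    gam (qlen X g a b) = g b &
    forall t, 0 <= t -> t <= qlen X g a b ->
      exists u, [/\ a <= u, u <= b, gam t = g u & qlen X g a u = t]].
Proof.
move=> AX gA; have gX := curve_in_subset AX gA.
have [ab cg rg gA'] := gA; pose V := qlen X g a.
have Va : V a = 0 by apply: qlen_self; exact: rectifiable_sub rg.
have VE u v : a <= u -> u <= v -> v <= b -> V v = V u + qlen X g u v.
  move=> au uv vb; apply: (qlenD oX bX au uv).
  exact: (curve_in_sub (lexx a) (le_trans au uv) vb gX).
have [m [M [m0 M0 mM]]] := inv_dist_boundary_bounded gX.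
have Vb u v : a <= u -> u <= v -> v <= b ->
    m * len g u v <= V v - V u /\ V v - V u <= M * len g u v.
  move=> au uv vb; rewrite (VE u v)// addrAC subrr add0r.
  apply: qlen_bounds => //; first exact: curve_in_sub gX.
  by move=> s us sv; apply: mM; [exact: le_trans us|exact: le_trans vb].
have l0 u v : a <= u -> u <= v -> v <= b -> 0 <= len g u v.
  by move=> au uv vb; exact: len_ge0 au uv vb rg.
have Vmono u v : a <= u -> u <= v -> v <= b -> V u <= V v.
  move=> au uv vb; have [+ _] := Vb u v au uv vb; have := l0 u v au uv vb; nra.
have onto : monotone_onto V a b.
  split=> // y ay yb.
  have [||u] := @IVT R V a b y ab.
  - apply: real_within_continuous => c ac cb e e0.
    have [n n0 H] := len_continuous ac cb cg rg (divr_gt0 e0 M0).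
    exists n => // u au ub; rewrite ltr_distl => /andP[cu uc].
    have [cu'|uc'] := leP c u.
      have := H c u ac (lexx c) cu' ub ltac:(lra) uc.
      rewrite ltr_pdivlMr// => h; have [_ h1] := Vb c u ac cu' ub.
      have := Vmono c u ac cu' ub; rewrite ltr_norml; lra.
    have := H u c au (ltW uc') (lexx c) cb cu ltac:(lra).
    rewrite ltr_pdivlMr// => h; have [_ h1] := Vb u c au (ltW uc') cb.
    have := Vmono u c au (ltW uc') cb; rewrite ltr_norml; lra.
  - by rewrite min_l ?max_r ?ay//; exact: Vmono.
  - by rewrite in_itv /= => /andP[au ub] <-; exists u.
have inj u v : a <= u -> u <= b -> a <= v -> v <= b -> V u = V v -> g u = g v.
  wlog uv : u v / u <= v.
    move=> wl au ub av vb E; have [uv|vu] := leP u v; first exact: wl.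
    by apply/esym/wl => //; exact: ltW.
  move=> au ub av vb E; apply: mdist_positivity; apply/le_anti.
  rewrite mdist_ge0 andbT; apply: (le_trans (mdist_len au uv vb rg)).
  have [+ _] := Vb u v au uv vb; have := l0 u v au uv vb; nra.
pose psi t := xget a [set u | [/\ a <= u, u <= b & V u = t]].
pose gam t := g (psi t).
have psiP t : 0 <= t -> t <= V b -> [/\ a <= psi t, psi t <= b & V (psi t) = t].
  by rewrite -{1}Va => t0 tb; have /(xgetPex a) := onto.2 t t0 tb.
have V0 u : a <= u -> u <= b -> 0 <= V u.
  by move=> au ub; rewrite -Va; exact: Vmono.
have gamV u : a <= u -> u <= b -> g u = gam (V u).
  move=> au ub; have [h1 h2 h3] := psiP (V u) (V0 u au ub) (Vmono u b au ub (lexx b)).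
  by apply: inj.
have [rgam _] := len_reparam_ge ab gamV onto rg; rewrite Va in rgam.
have gamX : curve_in A gam 0 (V b).
  split=> //; first exact: V0.
  - apply: (@lipschitz_continuous_on _ _ gam 0 (V b) m^-1) => s t s0 st tb.
    have [h1 h2 h3] := psiP s s0 (le_trans st tb).
    have [k1 k2 k3] := psiP t (le_trans s0 st) tb.
    have [uv|vu] := leP (psi s) (psi t); last first.
      have -> : s = t.
        by apply/le_anti; rewrite st -h3 -k3; apply: Vmono => //; exact: ltW.
      by rewrite mdistxx subrr mulr0.
    apply: le_trans (mdist_len h1 uv k2 rg) _.
    rewrite ler_pdivlMl//.
    by have [+ _] := Vb _ _ h1 uv k2; rewrite h3 k3.
  - move=> t t0 tb; have [h1 h2 _] := psiP t t0 tb; exact: gA'.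
exists gam; split=> //.
- split=> // s t s0 st tb.
  have sb := le_trans st tb.
  have [h1 h2 h3] := psiP s s0 sb.
  have [k1 k2 k3] := psiP t (le_trans s0 st) tb.
  move: st; rewrite le_eqVlt => /predU1P[<-|st].
    by rewrite subrr (qlen_self X (rectifiable_sub s0 (lexx s) sb rgam)).
  have uv : psi s <= psi t.
    rewrite leNgt; apply/negP => vu; have := st; rewrite ltNge => /negP; apply.
    by rewrite -h3 -k3; apply: Vmono => //; exact: ltW.
  have ouv := monotone_onto_sub h1 uv k2 onto.
  rewrite -{1}h3 -{1}k3 -(qlen_reparam oX bX (g := g) _ ouv).
  + by have := VE _ _ h1 uv k2; rewrite h3 k3; lra.
  + by move=> u u1 u2; apply: gamV; [exact: le_trans u1|exact: le_trans k2].
  + exact: curve_in_sub gX.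
  + apply: curve_in_subset AX _; apply: curve_in_sub gamX; first exact: V0.
    * exact: Vmono.
    * exact: Vmono.
- by rewrite -Va -gamV.
- by rewrite -/(V b) -gamV.
- by move=> t t0 tb; have [h1 h2 h3] := psiP t t0 tb; exists (psi t).
Qed.

End QuasihyperbolicLength.

(** * Quasihyperbolic distance and injective short curves *)

Section RestrictedDistance.
Context {R : realType} {T : metricType R}.
Variables X A : set T.
Hypotheses (oX : open X) (bX : boundary X !=set0) (AX : A `<=` X).
Implicit Types (g : R -> T) (x y z : T) (a b c u v : R).

Local Notation f := (fun p => (dist_boundary X p)^-1).

(** An inner distance of A: the curves stay in A, but the weight is still the distance to the
    boundary of X. For A = X it is convertible to [qh_dist X]. *)
Definition qh_dist_in x y : R :=
  inf [set l | exists g a b, rectifiable_curve A x y g a b /\ l = qh_length X g a b].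

(** Guards against an infimum over the empty set, whose value is 0. *)
Definition linked x y := exists g a b, rectifiable_curve A x y g a b.

Lemma rectifiable_curveP x y g a b :
  rectifiable_curve A x y g a b <-> [/\ curve_in A g a b, g a = x & g b = y].
Proof.
split=> [[ab /within_continuousP cg gA [gx gy] rg]|[[ab cg rg gA] gx gy]].
  split=> //; split=> // u au ub; apply: gA; exists u => //.
  by rewrite /= in_itv /= au ub.
split=> //; first exact/within_continuousP.
by move=> _ [u /= + <-]; rewrite in_itv /= => /andP[]; exact: gA.
Qed.

Lemma qh_dist_in_has_lbound x y :
  has_lbound [set l | exists g a b,
    rectifiable_curve A x y g a b /\ l = qh_length X g a b].
Proof.
exists 0 => _ [g [a [b [/rectifiable_curveP[gA _ _] ->]]]].
by rewrite qlenE; apply: qlen_ge0 => //; exact: curve_in_subset gA.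
Qed.

Lemma qh_dist_in_ge0 x y : 0 <= qh_dist_in x y.
Proof.
have [[l Sl]|/set0P/negP/negPn/eqP S0] := pselect ([set l | exists g a b,
    rectifiable_curve A x y g a b /\ l = qh_length X g a b] !=set0).
  apply: lb_le_inf; first by exists l.
  move=> _ [g [a [b [/rectifiable_curveP[gA _ _] ->]]]].
  by rewrite qlenE; apply: qlen_ge0 => //; exact: curve_in_subset gA.
by rewrite /qh_dist_in S0 inf0.
Qed.

Lemma qh_dist_in_le_qlen g a b : curve_in A g a b ->
  qh_dist_in (g a) (g b) <= qlen X g a b.
Proof.
move=> gA; apply: ge_inf; first exact: qh_dist_in_has_lbound.
by exists g, a, b; split; [exact/rectifiable_curveP|rewrite qlenE].
Qed.

Lemma qh_dist_in_le_param g (L : R) s t : qh_param X A g L ->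
  0 <= s -> s <= t -> t <= L -> qh_dist_in (g s) (g t) <= t - s.
Proof.
move=> [gA gq] s0 st tL; rewrite -gq//; apply: qh_dist_in_le_qlen.
exact: curve_in_sub gA.
Qed.

Lemma qh_dist_in_approx x y (e : R) : linked x y -> 0 < e ->
  exists g (L : R), [/\ qh_param X A g L, g 0 = x, g L = y &
    L < qh_dist_in x y + e].
Proof.
move=> [g0 [a0 [b0 xy0]]] e0.
have [|_ [g [a [b [/rectifiable_curveP[gA <- <-] ->]]]] lt_e] :=
    @inf_adherent R [set l | exists g a b,
      rectifiable_curve A x y g a b /\ l = qh_length X g a b] e e0.
  split; last exact: qh_dist_in_has_lbound.
  by exists (qh_length X g0 a0 b0), g0, a0, b0.
have [gam [h1 h2 h3 _]] := qh_param_exists oX bX AX gA.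
by exists gam, (qlen X g a b); split=> //; rewrite -qlenE.
Qed.

Lemma qh_dist_in_self x : A x -> qh_dist_in x x = 0.
Proof.
move=> Ax; apply/le_anti; rewrite qh_dist_in_ge0 andbT.
have cA : curve_in A (fun=> x) (0 : R) 0.
  split=> // [c _ _ e e0|]; first by exists 1 => // u _ _ _; rewrite mdistxx.
  have [|//] := @len_le _ _ (fun=> x) (fun=> 0) (0 : R) 0 (lexx _).
  by move=> u v _ _ _; rewrite mdistxx subrr.
have [_ _ r _] := cA.
by have := qh_dist_in_le_qlen cA; rewrite (qlen_self X r).
Qed.

Lemma linked_sym x y : linked x y -> linked y x.
Proof.
move=> [g [a [b /rectifiable_curveP[gA gx gy]]]].
exists (fun u => g (b - u)), 0, (b - a); apply/rectifiable_curveP; split.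
- apply: (curve_in_rev oX bX AX _).1.
  by rewrite subr0 subKr.
- by rewrite subr0.
- by rewrite subKr.
Qed.

Lemma qh_dist_in_sym x y : linked x y -> qh_dist_in x y = qh_dist_in y x.
Proof.
suff H p q : linked p q -> qh_dist_in q p <= qh_dist_in p q.
  by move=> xy; apply/le_anti; rewrite !H//; exact: linked_sym.
move=> pq; apply/ler_addgt0Pr => e e0.
have [g [L [[gA gq] <- <- lt_e]]] := qh_dist_in_approx pq e0.
have [L0 _ _ _] := gA.
have [|rA rq] := @curve_in_rev _ _ X oX bX A g 0 L L AX.
  by rewrite subrr subr0.
have := qh_dist_in_le_qlen rA; rewrite rq subrr subr0 gq// subr0 => /le_trans.
by apply; exact: ltW.
Qed.

Lemma qh_dist_in_triangle x y z : linked x y -> linked y z ->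
  qh_dist_in x z <= qh_dist_in x y + qh_dist_in y z.
Proof.
move=> xy yz; apply/ler_addgt0Pr => e e0; have e20 : 0 < e / 2 by lra.
have [g [L [[gA gq] gx gy lt_e]]] := qh_dist_in_approx xy e20.
have [g' [L' [[gA' gq'] gy' gz lt_e']]] := qh_dist_in_approx yz e20.
have [|g'' [c [h e1 e2 q]]] := curve_concat oX bX AX gA gA'.
  by rewrite gy gy'.
have [L0 _ _ _] := gA; have [L0' _ _ _] := gA'.
have := qh_dist_in_le_qlen h.
by rewrite e1 e2 gx gz q gq// gq'// !subr0; lra.
Qed.

Lemma linked_param g (L : R) s t : curve_in A g 0 L -> 0 <= s -> s <= t ->
  t <= L -> linked (g s) (g t).
Proof.
move=> gA s0 st tL; exists g, s, t; apply/rectifiable_curveP; split=> //.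
exact: curve_in_sub gA.
Qed.

(* On a curve of quasihyperbolic length L and length D starting at x the
   distance to the boundary is at most [dist_boundary X x + D], so that
   [L >= D / (dist_boundary X x + D)]. *)
Lemma mdist_le_qh_dist_in x y : A x -> linked x y ->
  mdist x y * (1 - qh_dist_in x y) <= dist_boundary X x * qh_dist_in x y.
Proof.
move=> Ax xy; set k := qh_dist_in x y; set d := mdist x y.
have D0 : 0 < dist_boundary X x by apply: dist_boundary_gt0 => //; exact: AX.
set D := dist_boundary X x in D0 *.
have d0 : 0 <= d by exact: mdist_ge0.
apply/ler_addgt0Pr => e e0; have s0 : 0 < D + d by lra.
have e'0 : 0 < e / (D + d) by rewrite divr_gt0.
have [g [L [[gA gq] gx gy lt_e]]] := qh_dist_in_approx xy e'0.
have gX := curve_in_subset AX gA; have [L0 cg rg _] := gA.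
have [m [M [_ M0 mM]]] := inv_dist_boundary_bounded oX bX gX.
set l := len g 0 L.
have dl : d <= l.
  by rewrite /d -gx -gy; exact: (mdist_len (lexx 0) L0 (lexx L) rg).
have : (D + l)^-1 * l <= L.
  rewrite -[leRHS]subr0 -gq//.
  have [|//] := qlen_bounds oX bX (m := (D + l)^-1) (M := M) gX.
  move=> s s0' sL; split; last by have [] := mM s s0' sL.
  have Dl0 : 0 < D + l by lra.
  have gs0 : 0 < dist_boundary X (g s).
    by apply: dist_boundary_gt0 => //; have [_ _ _] := gX; apply.
  rewrite lef_pV2 ?posrE//.
  apply: le_trans (dist_boundary_lipschitz bX (g s) x) _.
  rewrite lerD2l metric_sym -gx; apply: (le_trans (mdist_len (lexx 0) s0' sL rg)).
  rewrite /l (lenD (lexx 0) s0' sL (lexx L) rg) lerDl.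
  exact: len_ge0 s0' sL (lexx L) rg.
rewrite mulrC ler_pdivrMr; last by lra.
move=> lL.
(* For L < 1 the inequality l * (1 - L) <= L * D passes from l to the smaller d; for L >= 1 it is
   trivial. *)
have dL : d <= L * (D + d).
  have [L1|L1] := leP 1 L; first by nra.
  have : d * (1 - L) <= l * (1 - L) by apply: ler_wpM2r => //; lra.
  by lra.
have : L * (D + d) <= (k + e / (D + d)) * (D + d).
  by apply: ler_wpM2r; exact: ltW.
rewrite mulrDl divfK ?gt_eqF//; lra.
Qed.

End RestrictedDistance.

(** * Paths that are 1-Lipschitz for an inner distance *)

Section ShortArcs.
Context {R : realType} {T : metricType R}.
Variable X : set T.
Hypotheses (oX : open X) (bX : boundary X !=set0).

Section LipschitzPath.
Variables (A : set T) (eta : R -> T) (L : R).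
Hypotheses (AX : A `<=` X) (L0 : 0 <= L).
Hypothesis etaA : forall t, 0 <= t -> t <= L -> A (eta t).
Hypothesis linkedA : forall p q, A p -> A q -> linked A p q.
Hypothesis eta_lip : forall s t, 0 <= s -> s <= t -> t <= L ->
  qh_dist_in X A (eta s) (eta t) <= t - s.

Let delta p := dist_boundary X p.

Let pos p : A p -> 0 < delta p.
Proof. by move=> Ap; apply: dist_boundary_gt0 => //; exact: AX. Qed.

(** Near c the path is almost Lipschitz with constant [delta (eta c)], and [delta] is almost
    constant along it. The factor 1 - 2 * r comes from [mdist_le_qh_dist_in] at u and v, at most 2 *
    r apart, and 1 - r from the passage between c and u; both tend to 1 with r. *)
Lemma qh_lipschitz_local c r u v : 0 <= c -> c <= L -> 0 < r -> r <= 1 / 4 ->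
  0 <= u -> u <= v -> v <= L -> c - r <= u -> v <= c + r ->
  mdist (eta u) (eta v) * ((1 - 2 * r) * (1 - r)) <= delta (eta c) * (v - u) /\
  delta (eta c) * (1 - 2 * r) <= delta (eta u) * (1 - r).
Proof.
move=> c0 cL r0 r4 u0 uv vL cu vc.
have uL := le_trans uv vL; have v0 := le_trans u0 uv.
have Ac := etaA c0 cL; have Au := etaA u0 uL; have Av := etaA v0 vL.
have kcu : qh_dist_in X A (eta c) (eta u) <= r.
  have [cu'|uc] := leP c u; first by have := eta_lip c0 cu' uL; lra.
  rewrite (qh_dist_in_sym oX bX AX (linkedA Ac Au)).
  by have := eta_lip u0 (ltW uc) cL; lra.
have h1 : mdist (eta c) (eta u) * (1 - r) <= delta (eta c) * r.
  have := mdist_le_qh_dist_in oX bX AX Ac (linkedA Ac Au).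
  have := pos Ac; have := mdist_ge0 (eta c) (eta u).
  rewrite -/(delta (eta c)); nra.
have h2 : mdist (eta u) (eta v) * (1 - 2 * r) <= delta (eta u) * (v - u).
  have := mdist_le_qh_dist_in oX bX AX Au (linkedA Au Av).
  have := eta_lip u0 uv vL; have := pos Au; have := mdist_ge0 (eta u) (eta v).
  rewrite -/(delta (eta u)) => p1 p2 p3 p4.
  apply: (@le_trans _ _ (mdist (eta u) (eta v) *
    (1 - qh_dist_in X A (eta u) (eta v)))).
    by apply: ler_wpM2l => //; lra.
  by apply: (le_trans p4); apply: ler_wpM2l => //; exact: ltW.
have l1 := dist_boundary_lipschitz bX (eta u) (eta c).
have l2 := dist_boundary_lipschitz bX (eta c) (eta u).
rewrite -/(delta _) -/(delta _) metric_sym in l1; rewrite -/(delta _) -/(delta _) in l2.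
have h3 : delta (eta u) * (1 - r) <= delta (eta c).
  have : delta (eta u) * (1 - r) <=
      (delta (eta c) + mdist (eta c) (eta u)) * (1 - r).
    by apply: ler_wpM2r => //; lra.
  by lra.
have h4 : delta (eta c) * (1 - r) <=
    (delta (eta u) + mdist (eta c) (eta u)) * (1 - r).
  by apply: ler_wpM2r => //; lra.
split; last by lra.
apply: (@le_trans _ _ (delta (eta u) * (v - u) * (1 - r))).
  by rewrite mulrA; apply: ler_wpM2r => //; lra.
by rewrite mulrAC; apply: ler_wpM2r => //; lra.
Qed.

Lemma qh_lipschitz_mdist c r u v : 0 <= c -> c <= L -> 0 < r -> r <= 1 / 4 ->
  0 <= u -> u <= v -> v <= L -> c - r <= u -> v <= c + r ->
  mdist (eta u) (eta v) <= delta (eta c) / ((1 - 2 * r) * (1 - r)) * (v - u).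
Proof.
move=> c0 cL r0 r4 u0 uv vL cu vc.
have [h _] := qh_lipschitz_local c0 cL r0 r4 u0 uv vL cu vc.
by rewrite mulrAC ler_pdivlMr//; nra.
Qed.

(** Neither continuity nor rectifiability is assumed of [eta]; both follow from the local estimate
    with r = 1 / 4. *)
Lemma qh_lipschitz_curve_in : curve_in A eta 0 L.
Proof.
have q0 : 0 < 1 / 4 :> R by lra.
split=> //.
- move=> c c0 cL e e0.
  pose K := delta (eta c) / ((1 - 2 * (1 / 4)) * (1 - 1 / 4)) : R.
  have K0 : 0 < K by apply: divr_gt0; [exact/pos/etaA|lra].
  exists (Num.min (1 / 4) (e / K)) => [|u u0 uL]; first by rewrite lt_min q0 divr_gt0.
  rewrite lt_min (ltr_pdivlMr _ _ K0) => /andP[]; rewrite ltr_norml => /andP[h1 h2].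
  have [cu|uc] := leP c u.
    rewrite ger0_norm ?subr_ge0// mulrC; apply: le_lt_trans.
    apply: qh_lipschitz_mdist => //; lra.
  rewrite distrC gtr0_norm ?subr_gt0// mulrC metric_sym; apply: le_lt_trans.
  by apply: qh_lipschitz_mdist => //; lra.
- apply: (@interval_induction _ (fun s t => rectifiable_on eta s t)) => //.
    move=> s m t _ sm mt _ r1 r2; exact: (lenD_rectifiable sm mt r1 r2).1.
  move=> c c0 cL; exists (1 / 4) => // s t s0 sc ct tL cs tc.
  pose K := delta (eta c) / ((1 - 2 * (1 / 4)) * (1 - 1 / 4)) : R.
  have [|//] := @len_le _ _ eta (fun t => K * t) s t (le_trans sc ct).
  move=> u v su uv vt; rewrite -mulrBr.
  by apply: qh_lipschitz_mdist => //; lra.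
Qed.

(** Locally, the bound on the weight times the Lipschitz constant is (1 - 2 * r)^-2: the distance D
    to the boundary cancels. *)
Lemma qh_lipschitz_qlen : qlen X eta 0 L <= L.
Proof.
have cA := qh_lipschitz_curve_in; have cX := curve_in_subset AX cA.
suff H (e : R) : 0 < e -> e <= 1 -> qlen X eta 0 L <= (1 + e) * L.
  apply/ler_addgt0Pr => e e0; have L10 : 0 < L + 1 by rewrite ltr_wpDl.
  have e'0 : 0 < Num.min 1 (e / (L + 1)) by rewrite lt_min ltr01 divr_gt0.
  have e'1 : Num.min 1 (e / (L + 1)) <= 1 by rewrite ge_min lexx.
  have : Num.min 1 (e / (L + 1)) <= e / (L + 1) by rewrite ge_min lexx orbT.
  rewrite ler_pdivlMr// => h; apply: (le_trans (H _ e'0 e'1)).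
  rewrite mulrDl mul1r lerD2l; apply: le_trans h.
  by apply: ler_wpM2l; [exact: ltW|lra].
move=> e0 e1.
have := @interval_induction _ (fun s t => qlen X eta s t <= (1 + e) * (t - s)) 0 L L0.
rewrite subr0; apply.
  move=> s m t s0 sm mt tL h1 h2.
  rewrite (qlenD oX bX sm mt (curve_in_sub s0 (le_trans sm mt) tL cX)); lra.
(* For e <= 1 this r gives (1 - 2 * r)^-2 <= 1 + e. *)
move=> c c0 cL; pose r := e / 8; have r0 : 0 < r by rewrite /r; lra.
have r4 : r <= 1 / 4 by rewrite /r; lra.
exists r => // s t s0 sc ct tL cs tc; have st := le_trans sc ct.
have Dc := pos (etaA c0 cL); set D := delta (eta c) in Dc *.
have cst := curve_in_sub s0 st tL cX; have [_ _ rst _] := cst.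
have q2 : 0 < 1 - 2 * r by lra.
have q1 : 0 < 1 - r by lra.
have [|_ ls] := @len_le _ _ eta (fun t => D / ((1 - 2 * r) * (1 - r)) * t) s t st.
  by move=> u v su uv vt; rewrite -mulrBr; apply: qh_lipschitz_mdist => //; lra.
rewrite -mulrBr in ls.
have [m [M [_ _ mM]]] := inv_dist_boundary_bounded oX bX cst.
have [|_ qs] := qlen_bounds oX bX (m := m) (M := (1 - r) / (D * (1 - 2 * r))) cst.
  move=> u su ut; split; first by have [] := mM u su ut.
  have u0 := le_trans s0 su; have uL := le_trans ut tL.
  have [_ h] := @qh_lipschitz_local c r u u c0 cL r0 r4 u0 (lexx u) uL
    ltac:(lra) ltac:(lra).
  have du := pos (etaA u0 uL).
  by rewrite ler_pdivlMr ?mulr_gt0// mulrC ler_pdivrMr// mulrC; lra.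
apply: (le_trans qs).
have : (1 - r) / (D * (1 - 2 * r)) * len eta s t <=
  (1 - r) / (D * (1 - 2 * r)) * (D / ((1 - 2 * r) * (1 - r)) * (t - s)).
  by apply: ler_wpM2l => //; rewrite divr_ge0 ?mulr_ge0// ltW.
move/le_trans; apply.
have -> : (1 - r) / (D * (1 - 2 * r)) * (D / ((1 - 2 * r) * (1 - r)) * (t - s)) =
  (t - s) / (1 - 2 * r) ^+ 2 by field; rewrite !gt_eqF.
rewrite ler_pdivrMr ?exprn_gt0// -mulrA mulrC -mulrA.
rewrite -[leLHS]mulr1; apply: ler_wpM2l; first by lra.
rewrite /r; nra.
Qed.

End LipschitzPath.

End ShortArcs.

(** An ultrafilter converges to any of its cluster points. One ultrafilter thus serves uncountably
    many parameters at once, with no subsequence to extract. *)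
Lemma ultra_segment_cvg (R : realType) (I : Type) (G : set_system I)
    (tau : I -> R) (a b : R) : UltraFilter G ->
  (forall i, a <= tau i /\ tau i <= b) ->
  exists t, [/\ a <= t, t <= b &
    forall e : R, 0 < e -> G [set i | `|tau i - t| < e]].
Proof.
move=> UG tauab.
have [|t [/= + clt]] := @segment_compact R a b (tau @ G) _.
  rewrite /fmap /=; apply: (@filterS _ G _ setT) filterT => i _ /=.
  by rewrite in_itv /=; have [-> ->] := tauab i.
rewrite in_itv /= => /andP[at_ tb]; exists t; split=> // e e0.
have [//|Gn] := in_ultra_setVsetC [set i | `|tau i - t| < e] UG.
have [|s [/= ns te]] := clt (~` [set s | `|s - t| < e]) (ball t e) Gn.
  exact: nbhsx_ballx.
by case: ns; move: te; rewrite /ball /= distrC.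
Qed.

(** * Injective curves that are not longer than a given one *)

Section ArcExistence.
Context {R : realType} {T : metricType R}.
Variable X : set T.
Hypotheses (oX : open X) (bX : boundary X !=set0).

(* The arc is a geodesic for the restriction to the image A of g of the
   quasihyperbolic length: it is an ultrafilter limit, in the compact parameter
   interval of g, of almost shortest curves in A. *)
Lemma qh_arc_exists (g : R -> T) (L : R) : qh_param X X g L ->
  exists (gam : R -> T) (L' : R), [/\ qh_param X X gam L', gam 0 = g 0,
    gam L' = g L, L' <= L &
    forall s t : R, 0 <= s -> s <= L' -> 0 <= t -> t <= L' -> gam s = gam t -> s = t].
Proof.
move=> [gX gq]; have [L0 cg rg gX'] := gX.
pose A : set T := [set p | exists u : R, [/\ 0 <= u, u <= L & p = g u]].
have AX : A `<=` X by move=> _ [u [u0 uL ->]]; exact: gX'.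
have gA : curve_in A g 0 L by split=> // u u0 uL; exists u.
have gAq : qh_param X A g L by [].
have Ag u : 0 <= u -> u <= L -> A (g u) by move=> u0 uL; exists u.
have lg u v : 0 <= u -> u <= L -> 0 <= v -> v <= L -> linked A (g u) (g v).
  move=> u0 uL v0 vL; have [uv|vu] := leP u v.
    exact: linked_param gA u0 uv vL.
  exact/(linked_sym oX bX AX)/(linked_param gA v0 (ltW vu) uL).
have linkedA p q : A p -> A q -> linked A p q.
  by move=> [u [u0 uL ->]] [v [v0 vL ->]]; exact: lg.
pose k := qh_dist_in X A.
have ksym p q : A p -> A q -> k p q = k q p.
  by move=> Ap Aq; apply: qh_dist_in_sym => //; exact: linkedA.
have ktri p q r : A p -> A q -> A r -> k p r <= k p q + k q r.
  by move=> Ap Aq Ar; apply: qh_dist_in_triangle => //; exact: linkedA.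
have k0 p q : 0 <= k p q by exact: qh_dist_in_ge0.
have klip u v : 0 <= u -> u <= L -> 0 <= v -> v <= L -> k (g u) (g v) <= `|u - v|.
  move=> u0 uL v0 vL; have [uv|vu] := leP u v.
    rewrite distrC ger0_norm ?subr_ge0//; exact: qh_dist_in_le_param gAq _ uv vL.
  rewrite (ksym _ _ (Ag u u0 uL) (Ag v v0 vL)) gtr0_norm ?subr_gt0//.
  exact: qh_dist_in_le_param gAq v0 (ltW vu) uL.
have ksep p q : A p -> A q -> (forall e : R, 0 < e -> k p q <= e) -> p = q.
  move=> Ap Aq H; have kpq : k p q = 0.
    by apply/le_anti; rewrite k0 andbT; apply/ler_addgt0Pr => e e0; rewrite add0r H.
  apply: mdist_positivity; apply/le_anti; rewrite mdist_ge0 andbT.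
  have := mdist_le_qh_dist_in oX bX AX Ap (linkedA _ _ Ap Aq).
  by rewrite -/(k p q) kpq subr0 mulr1 mulr0.
set x := g 0; set y := g L; pose l := k x y.
have Ax : A x by exact: Ag.
have Ay : A y by exact: Ag.
have l0 : 0 <= l by exact: k0.
have lL : l <= L.
  by have := qh_dist_in_le_param bX AX gAq (lexx 0) L0 (lexx L); rewrite subr0.
have near_geodesic (n : nat) : exists tau : R -> R,
    (forall s, 0 <= s -> s <= l -> 0 <= tau s /\ tau s <= L) /\
    [/\ forall s t, 0 <= s -> s <= t -> t <= l ->
          k (g (tau s)) (g (tau t)) <= t - s,
        g (tau 0) = x & k (g (tau l)) y <= n.+1%:R^-1].
  have n0 : 0 < n.+1%:R^-1 :> R by rewrite invr_gt0.
  have [h [M [hM h0 hL lt_n]]] := qh_dist_in_approx oX bX AX (linkedA x y Ax Ay) n0.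
  have [[M0 _ _ hA] _] := hM.
  have lM : l <= M.
    have := qh_dist_in_le_param bX AX hM (lexx 0) M0 (lexx M).
    by rewrite h0 hL subr0.
  have /choice[tau tauP] (s : R) : exists u, 0 <= s -> s <= M ->
      [/\ 0 <= u, u <= L & h s = g u].
    have [s0|s0] := leP 0 s; last by exists 0.
    have [sM|sM] := leP s M; last by exists 0.
    by have [u Hu] := hA s s0 sM; exists u.
  exists tau; split=> [s s0 sl|].
    by have [] := tauP s s0 (le_trans sl lM).
  split=> [s t s0 st tl||].
  - have [_ _ <-] := tauP s s0 (le_trans (le_trans st tl) lM).
    have [_ _ <-] := tauP t (le_trans s0 st) (le_trans tl lM).
    exact: qh_dist_in_le_param hM s0 st (le_trans tl lM).
  - by have [_ _ <-] := tauP 0 (lexx 0) M0.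
  - have [_ _ <-] := tauP l l0 lM; rewrite -hL.
    apply: le_trans (qh_dist_in_le_param bX AX hM l0 lM (lexx M)) _.
    by rewrite lerBlDl; apply: ltW.
have [tau tauP] := choice near_geodesic.
have [G [UG sG]] := @ultraFilterLemma nat \oo _.
(* The [tau n] need not be continuous: limits are taken for each s separately, and regularity of the
   limit comes from [eta_lip]. *)
have /choice[sig sigP] (s : R) : exists t, 0 <= s -> s <= l -> [/\ 0 <= t, t <= L &
    forall e : R, 0 < e -> G [set n | `|tau n s - t| < e]].
  have [s0|s0] := leP 0 s; last by exists 0.
  have [sl|sl] := leP s l; last by exists 0.
  have [t Ht] := @ultra_segment_cvg R nat G (tau ^~ s) 0 L UG
    (fun n => (tauP n).1 s s0 sl).
  by exists t.
pose eta s := g (sig s).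
have etaA s : 0 <= s -> s <= l -> A (eta s).
  by move=> s0 sl; have [h1 h2 _] := sigP s s0 sl; exact: Ag.
have eta_near s (e : R) : 0 <= s -> s <= l -> 0 < e ->
    G [set n | k (g (tau n s)) (eta s) <= e].
  move=> s0 sl e0; have [t0 tL H] := sigP s s0 sl.
  apply: filterS (H e e0) => n /= ne; have [h1 h2] := (tauP n).1 s s0 sl.
  by apply: (le_trans (klip _ _ h1 h2 t0 tL)); exact: ltW.
have Atau n s : 0 <= s -> s <= l -> A (g (tau n s)).
  by move=> s0 sl; have [h1 h2] := (tauP n).1 s s0 sl; exact: Ag.
have eta_lip s t : 0 <= s -> s <= t -> t <= l -> k (eta s) (eta t) <= t - s.
  move=> s0 st tl; have sl := le_trans st tl; have t0 := le_trans s0 st.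
  apply/ler_addgt0Pr => e e0; have e20 : 0 < e / 2 by lra.
  have [n [/= ns nt]] := filter_ex (filterI (eta_near s _ s0 sl e20)
    (eta_near t _ t0 tl e20)).
  have [_ [H _ _]] := tauP n; have := H s t s0 st tl.
  have := ktri _ _ _ (etaA s s0 sl) (Atau n s s0 sl) (etaA t t0 tl).
  have := ktri _ _ _ (Atau n s s0 sl) (Atau n t t0 tl) (etaA t t0 tl).
  rewrite (ksym _ _ (etaA s s0 sl) (Atau n s s0 sl)); lra.
have eta0 : eta 0 = x.
  apply: ksep => // [|e e0]; first exact: etaA.
  have [n /= H] := filter_ex (eta_near 0 e (lexx 0) l0 e0).
  have [_ [_ tau0 _]] := tauP n; rewrite (ksym _ _ (etaA 0 (lexx 0) l0) Ax).
  by rewrite -tau0.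
have etal : eta l = y.
  apply: ksep => // [|e e0]; first exact: etaA.
  have e20 : 0 < e / 2 by lra.
  have Gn : G [set n | n.+1%:R^-1 < e / 2].
    by apply: sG; exact: near_infty_natSinv_lt (PosNum e20).
  have [n [/= nl ne]] := filter_ex (filterI (eta_near l _ l0 (lexx l) e20) Gn).
  have [_ [_ _ /le_trans/(_ (ltW ne)) taul]] := tauP n.
  have {ne} := ktri _ _ _ (etaA l l0 (lexx l)) (Atau n l l0 (lexx l)) Ay.
  rewrite (ksym _ _ (etaA l l0 (lexx l)) (Atau n l l0 (lexx l))); lra.
have cA := qh_lipschitz_curve_in oX bX AX l0 etaA linkedA eta_lip.
have ql := qh_lipschitz_qlen oX bX AX l0 etaA linkedA eta_lip.
have [gam [gamq gam0 gaml gamP]] := qh_param_exists oX bX AX cA.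
(* Cutting out a loop would bound k x y by l - (v - u), while k x y = l. *)
have eta_inj u v : 0 <= u -> u <= v -> v <= l -> eta u = eta v -> u = v.
  move=> u0 uv vl E; apply/le_anti; rewrite uv /=.
  have ul := le_trans uv vl; have v0 := le_trans u0 uv.
  have := eta_lip 0 u (lexx 0) u0 ul; have := eta_lip v l v0 vl (lexx l).
  have := ktri x (eta u) y Ax (etaA u u0 ul) Ay.
  rewrite eta0 etal -E -/l; lra.
exists gam, (qlen X eta 0 l); split.
- by case: gamq => h1 h2; split=> //; exact: curve_in_subset h1.
- by rewrite gam0.
- by rewrite gaml.
- exact: le_trans lL.
- move=> s t s0 sl t0 tl.
  have [u [u0 ul -> <-]] := gamP s s0 sl; have [v [v0 vl -> <-]] := gamP t t0 tl.
  have [uv|vu] := leP u v; first by move=> /eta_inj ->.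
  by move=> /esym /eta_inj ->//; exact: ltW.
Qed.

End ArcExistence.

(** * Short paths in Gromov hyperbolic spaces *)

Section FellowTravelling.
Context {R : realType} {T : Type}.
Variables (X : T -> Prop) (k : T -> T -> R) (delta h : R).

Definition gproduct w x y : R := (k x w + k y w - k x y) / 2.

Definition pseudometric_on :=
  [/\ forall x, X x -> k x x = 0,
      forall x y, X x -> X y -> 0 <= k x y,
      forall x y, X x -> X y -> k x y = k y x &
      forall x y z, X x -> X y -> X z -> k x z <= k x y + k y z].

Definition hyperbolic_on := forall x y z w, X x -> X y -> X z -> X w ->
  Num.min (gproduct w x z) (gproduct w z y) - delta <= gproduct w x y.

Hypothesis kP : pseudometric_on.
Hypothesis hyp : hyperbolic_on.
Hypotheses (delta_ge0 : 0 <= delta) (h_ge0 : 0 <= h).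

Let ksym x y : X x -> X y -> k x y = k y x.
Proof. by case: kP => _ _ + _ => /[apply] /[apply]. Qed.

Let ktri x y z : X x -> X y -> X z -> k x z <= k x y + k y z.
Proof. by case: kP => _ _ _ H Xx Xy Xz; exact: H. Qed.

Lemma gproduct_self w x : X w -> X x -> gproduct w x x = k x w.
Proof.
by move=> Xw Xx; case: kP => k0 _ _ _; rewrite /gproduct (k0 x Xx); lra.
Qed.

Lemma gproduct_sym w x y : X x -> X y -> gproduct w x y = gproduct w y x.
Proof. by move=> Xx Xy; rewrite /gproduct (ksym Xx Xy) (addrC (k x w)). Qed.

Lemma gproduct_base w o x y : X w -> X o -> X x -> X y ->
  gproduct w x y - k o w <= gproduct o x y.
Proof.
move=> Xw Xo Xx Xy; rewrite /gproduct.
have := ktri Xx Xo Xw; have := ktri Xy Xo Xw; lra.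
Qed.

Lemma gproduct_min w x y z (B : R) : X x -> X y -> X z -> X w ->
  B <= gproduct w x z -> B <= gproduct w z y -> B - delta <= gproduct w x y.
Proof.
move=> Xx Xy Xz Xw h1 h2; apply: le_trans (hyp Xx Xy Xz Xw).
by rewrite lerD2r le_min h1.
Qed.

(** Expanding the products in the hyperbolicity inequality leaves a form without a base point. *)
Lemma four_point x y z w : X x -> X y -> X z -> X w ->
  k x y + k z w <= k x z + k y w + 2 * delta \/
  k x y + k z w <= k z y + k x w + 2 * delta.
Proof.
move=> Xx Xy Xz Xw; have := hyp Xx Xy Xz Xw.
rewrite lerBlDr ge_min /gproduct => /orP[] H; [left|right]; lra.
Qed.

Definition short_path (beta : R -> T) (L : R) :=
  [/\ 0 <= L, forall s, 0 <= s -> s <= L -> X (beta s),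
      forall s t, 0 <= s -> s <= t -> t <= L -> k (beta s) (beta t) <= t - s &
      L <= k (beta 0) (beta L) + h].

(** A piece saving more than h would make the whole path save more than h. *)
Lemma short_path_ge beta L s t : short_path beta L -> 0 <= s -> s <= t ->
  t <= L -> t - s - h <= k (beta s) (beta t).
Proof.
move=> [L0 bX lip short] s0 st tL; have t0 := le_trans s0 st.
have sL := le_trans st tL.
have := lip 0 s (lexx 0) s0 sL; have := lip t L t0 tL (lexx L).
have := ktri (bX 0 (lexx 0) L0) (bX s s0 sL) (bX L L0 (lexx L)).
have := ktri (bX s s0 sL) (bX t t0 tL) (bX L L0 (lexx L)).
lra.
Qed.

(** In a tree the distance from z to a point of a geodesic is the larger of these two expressions
    without the errors. Here the four point condition is applied to z, the point and the two
    ends. *)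
Lemma short_path_dist beta L s z : short_path beta L -> 0 <= s -> s <= L ->
  X z -> k (beta s) z <= k z (beta L) - (L - s) + h + 2 * delta \/
         k (beta s) z <= k z (beta 0) - s + h + 2 * delta.
Proof.
move=> [L0 bX lip short] s0 sL Xz.
have X0 := bX 0 (lexx 0) L0; have XL := bX L L0 (lexx L); have Xs := bX s s0 sL.
have := lip 0 s (lexx 0) s0 sL; have := lip s L s0 sL (lexx L).
rewrite (ksym X0 Xs) (ksym Xz X0) => h1 h2.
by have [H|H] := four_point Xs Xz X0 XL; [left|right]; lra.
Qed.

(* The point of the path at which both bounds of [short_path_dist] agree. *)
Lemma short_path_balanced beta L z : short_path beta L -> X z ->
  exists s, [/\ 0 <= s, s <= L &
    k (beta s) z <= gproduct z (beta 0) (beta L) + h + 2 * delta].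
Proof.
move=> sh Xz; have [L0 bX lip short] := sh.
have X0 := bX 0 (lexx 0) L0; have XL := bX L L0 (lexx L).
have e1 := lip 0 L (lexx 0) L0 (lexx L).
have e2 := ktri Xz X0 XL; have e3 := ktri Xz XL X0.
have e4 := ksym X0 XL; have e5 := ksym X0 Xz; have e6 := ksym XL Xz.
pose s := (k z (beta 0) - k z (beta L) + L) / 2.
have s0 : 0 <= s by rewrite /s; lra.
have sL : s <= L by rewrite /s; lra.
exists s; split=> //; rewrite /gproduct.
by have [H|H] := short_path_dist sh s0 sL Xz; rewrite /s in H *; lra.
Qed.

Lemma short_path_gproduct beta L s : short_path beta L -> 0 <= s -> s <= L ->
  gproduct (beta s) (beta 0) (beta L) <= h / 2.
Proof.
move=> [L0 bX lip short] s0 sL; rewrite /gproduct.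
have := lip 0 s (lexx 0) s0 sL; have := lip s L s0 sL (lexx L).
rewrite (ksym (bX s s0 sL) (bX L L0 (lexx L))); lra.
Qed.

(* Along sequences converging to the same boundary point the functions
   [k z x - k z' x] of a boundary point x agree up to [2 * delta]. *)
Lemma busemann_comparison o x x' z z' : X o -> X x -> X x' -> X z -> X z' ->
  k z o + k z' o + k z z' + 2 * delta < 2 * gproduct o x x' ->
  k z x + k z' x' <= k z x' + k z' x + 2 * delta.
Proof.
move=> Xo Xx Xx' Xz Xz'; rewrite /gproduct => H.
have := ktri Xx Xz Xo; have := ktri Xx' Xz' Xo.
rewrite (ksym Xx Xz) (ksym Xx' Xz').
(* The first alternative, with [k z z'] and [k x x'], would make the product of x and x' too
   small. *)
by have [|] := four_point Xz Xx Xz' Xx'; lra.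
Qed.

(** [short_path_dist] bounds the distance from [beta (s + t)] to z by the distance from z to one end
    of [beta], up to h + 2 * delta. The comparison of z with z' replaces this by distances along
    [beta'], known up to h, at the price of 2 * delta; the terms in t cancel. *)
Lemma short_path_tracking beta L beta' L' o s s' t :
  short_path beta L -> short_path beta' L' -> X o ->
  0 <= s -> s <= L -> 0 <= s' -> s' <= L' ->
  0 <= s + t -> s + t <= L -> 0 <= s' + t -> s' + t <= L' ->
  let B := k (beta' (s' + t)) o + k (beta' s') o + `|t| + 2 * delta in
  B < 2 * gproduct o (beta 0) (beta' 0) ->
  B < 2 * gproduct o (beta L) (beta' L') ->
  k (beta (s + t)) (beta' (s' + t)) <= k (beta s) (beta' s') + 2 * h + 4 * delta.
Proof.
move=> sh sh' Xo s0 sL s'0 s'L st0 stL s't0 s'tL B.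
have [L0 bX lip short] := sh; have [L'0 b'X lip' short'] := sh'.
set u := beta (s + t); set z := beta' (s' + t); set z' := beta' s'.
have X0 := bX 0 (lexx 0) L0; have XL := bX L L0 (lexx L).
have X'0 := b'X 0 (lexx 0) L'0; have X'L := b'X L' L'0 (lexx L').
have Xs := bX s s0 sL; have Xz : X z by exact: b'X. have Xz' : X z' by exact: b'X.
have kzz' : k z z' <= `|t|.
  have [t0|t0] := leP 0 t.
    rewrite (ksym Xz Xz') (ger0_norm t0).
    have h1 : s' <= s' + t by lra.
    by have := lip' s' (s' + t) s'0 h1 s'tL; rewrite -/z -/z'; lra.
  rewrite (ltr0_norm t0); have h1 : s' + t <= s' by lra.
  by have := lip' (s' + t) s' s't0 h1 s'L; rewrite -/z -/z'; lra.
rewrite /B -/z -/z' => B0 BL.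
have H0 : k z (beta 0) + k z' (beta' 0) <= k z (beta' 0) + k z' (beta 0) + 2 * delta.
  by apply: (@busemann_comparison o) => //; lra.
have HL : k z (beta L) + k z' (beta' L') <= k z (beta' L') + k z' (beta L) + 2 * delta.
  by apply: (@busemann_comparison o) => //; lra.
have a1 := lip' 0 (s' + t) (lexx 0) s't0 s'tL.
have a2 := lip' (s' + t) L' s't0 s'tL (lexx L').
have a3 := short_path_ge sh' (lexx 0) s'0 s'L.
have a4 := short_path_ge sh' s'0 s'L (lexx L').
have a5 := ktri Xz' Xs X0; have a6 := ktri Xz' Xs XL.
have a7 := lip 0 s (lexx 0) s0 sL; have a8 := lip s L s0 sL (lexx L).
rewrite -/z -/z' in a1 a2 a3 a4.
rewrite (ksym X'0 Xz) in a1; rewrite (ksym X'0 Xz') in a3.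
rewrite (ksym Xz' Xs) in a5 a6; rewrite (ksym X0 Xs) in a7.
by have [H|H] := short_path_dist sh st0 stL Xz; rewrite -/u in H; lra.
Qed.

Definition tends_to_boundary w (x : nat -> T) := forall B : R,
  exists N, forall n m, (N <= n)%N -> (N <= m)%N -> B <= gproduct w (x n) (x m).

(** Ensures that the ends of the shortened arcs still represent the original boundary points. *)
Lemma boundary_shadow w (x x' : nat -> T) (n : nat -> nat) (D : R) :
  X w -> (forall i, X (x i)) -> (forall i, X (x' i)) -> tends_to_boundary w x ->
  (forall i, (i <= n i)%N) ->
  (forall i, i%:R - D <= gproduct w (x (n i)) (x' i)) ->
  tends_to_boundary w x' /\
  forall B : R, exists N, forall i, (N <= i)%N -> B <= gproduct w (x i) (x' i).
Proof.
move=> Xw Xx Xx' bx ni H; have d0 := delta_ge0.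
have H' (B : R) : exists N, forall i, (N <= i)%N -> B <= gproduct w (x (n i)) (x' i).
  exists (Num.truncn `|B + D|).+1 => i Ni; apply: le_trans (H i).
  have : `|B + D| <= i%:R.
    by apply: le_trans (ltW (truncnS_gt _)) _; rewrite ler_nat.
  by have := ler_norm (B + D); lra.
split=> B.
- have [N HN] := bx (B + 2 * delta); have [M HM] := H' (B + 2 * delta).
  exists (maxn N M) => i j; rewrite !geq_max => /andP[Ni Mi] /andP[Nj Mj].
  have h1 := HN _ _ (leq_trans Ni (ni i)) (leq_trans Nj (ni j)).
  have h2 := HM i Mi; have h3 := HM j Mj.
  (* The chain x' i, x (n i), x (n j), x' j has two intermediate terms, hence the margin 2 *
     delta. *)
  have h4 : B + delta <= gproduct w (x (n i)) (x' j).
    have -> : B + delta = B + 2 * delta - delta by lra.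
    exact: gproduct_min h1 h3.
  have -> : B = B + delta - delta by lra.
  apply: (@gproduct_min _ _ _ (x (n i))) => //.
  by rewrite (gproduct_sym w (Xx' i) (Xx (n i))); apply: le_trans h2; lra.
- have [N HN] := bx (B + delta); have [M HM] := H' (B + delta).
  exists (maxn N M) => i; rewrite geq_max => /andP[Ni Mi].
  have h1 := HN _ _ Ni (leq_trans Ni (ni i)); have h2 := HM i Mi.
  have -> : B = B + delta - delta by lra.
  exact: gproduct_min h1 h2.
Qed.

(** From [beta s] both points on one side are seen at their parameter distance, up to h, and the
    nearer one lies at distance r; replacing [beta s] by o costs [rho]. *)
Lemma short_path_shadow beta L o s r (rho : R) : short_path beta L -> X o ->
  0 <= r -> r <= s -> s + r <= L -> k (beta s) o <= rho ->
  r - h - rho <= gproduct o (beta 0) (beta (s - r)) /\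
  r - h - rho <= gproduct o (beta L) (beta (s + r)).
Proof.
move=> sh Xo r0 rs sr so; have [L0 bX lip short] := sh.
have s0 : 0 <= s by lra.
have sL : s <= L by lra.
have p0 : 0 <= s - r by lra.
have ps : s - r <= s by lra.
have pL : s - r <= L by lra.
have q0 : 0 <= s + r by lra.
have qs : s <= s + r by lra.
have X0 := bX 0 (lexx 0) L0; have XL := bX L L0 (lexx L); have Xs := bX s s0 sL.
have Xp := bX _ p0 pL; have Xq := bX _ q0 sr.
have a1 := short_path_ge sh (lexx 0) s0 sL.
have a2 := lip 0 (s - r) (lexx 0) p0 pL.
have a3 := short_path_ge sh p0 ps sL.
have b1 := short_path_ge sh s0 sL (lexx L).
have b2 := lip (s + r) L q0 sr (lexx L).
have b3 := short_path_ge sh s0 qs sr.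
have c1 := ktri X0 Xo Xs; have c2 := ktri Xp Xo Xs.
have c3 := ktri XL Xo Xs; have c4 := ktri Xq Xo Xs.
rewrite (ksym Xo Xs) in c1 c2 c3 c4.
rewrite (ksym Xs XL) in b1; rewrite (ksym Xs Xq) in b3.
rewrite (ksym Xq XL) in b2.
rewrite /gproduct; split; lra.
Qed.

(** [good] carries along what is needed to turn the paths into arcs. The hypothesis on B says that x
    and y do not converge to the same boundary point. *)
Lemma fellow_travelling_paths (good : (R -> T) -> R -> Prop) w (x y : nat -> T) :
  (forall p q, X p -> X q -> 0 < k p q -> exists beta L,
    [/\ good beta L, short_path beta L, beta 0 = p & beta L = q]) ->
  X w -> (forall i, X (x i)) -> (forall i, X (y i)) ->
  tends_to_boundary w x -> tends_to_boundary w y ->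
  (exists B : R, forall N, exists2 n, (N <= n)%N & gproduct w (x n) (y n) < B) ->
  exists (beta : nat -> R -> T) (L s : nat -> R) (n : nat -> nat) (o : T) (rho : R),
  [/\ X o,
      forall i, [/\ good (beta i) (L i), short_path (beta i) (L i),
        beta i 0 = x (n i) & beta i (L i) = y (n i)],
      forall i, [/\ (i <= n i)%N, i.+1%:R <= s i, s i + i.+1%:R <= L i &
        k (beta i (s i)) o <= rho] &
      forall i j (t : R), (i <= j)%N -> `|t| <= i.+1%:R ->
        k (beta i (s i + t)) (beta j (s j + t)) <= 12 * (delta + h)].
Proof.
move=> good_exists Xw Xx Xy bx by_ [B HB]; have d0 := delta_ge0; have h0 := h_ge0.
(* C bounds the distance from o to w. Products at least B0 at w are at least h + 3 * delta + 1 at o,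
   which excludes the unwanted alternatives in [oxy]. *)
pose C := B + h + 2 * delta; pose B0 := C + h + 3 * delta + 1.
have [N1 HN1] := bx B0; have [N2 HN2] := by_ B0.
pose N0 := maxn N1 N2.
have [n0 n0N Bn0] := HB N0.
have n0N1 : (N1 <= n0)%N by exact: leq_trans (leq_maxl _ _) n0N.
have n0N2 : (N2 <= n0)%N by exact: leq_trans (leq_maxr _ _) n0N.
have [beta0 [L0 [_ sh0 b0x b0y]]] : exists beta L,
    [/\ good beta L, short_path beta L, beta 0 = x n0 & beta L = y n0].
  apply: good_exists => //.
  have := HN1 n0 n0 n0N1 n0N1; have := HN2 n0 n0 n0N2 n0N2.
  rewrite (gproduct_self Xw (Xx n0)) (gproduct_self Xw (Xy n0)).
  move: Bn0; rewrite /gproduct /B0 /C; lra.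
have [s0 [s00 s0L wo]] := short_path_balanced sh0 Xw.
have [_ bX0 _ _] := sh0; pose o := beta0 s0; have Xo : X o by exact: bX0.
have oC : k o w <= C by move: wo Bn0; rewrite b0x b0y -/o /C; lra.
(* The sum of h / 2 + 2 * delta from [oxy] and h + 2 * delta from [short_path_balanced]. *)
pose rho := 4 * delta + 3 * h / 2.
(* For |t| <= i + 1 the bound required by [short_path_tracking] is at most 2 * K i - 2. K i also
   keeps both ends of the path at distance at least i + 1 from its centre. *)
pose K i : R := i.+1%:R + rho + delta + 1.
have base p q (E : R) : X p -> X q -> E + C <= gproduct w p q -> E <= gproduct o p q.
  by move=> Xp Xq; have := gproduct_base Xw Xo Xp Xq; lra.
have /choice[N HN] (i : nat) : exists N, forall n m, (N <= n)%N -> (N <= m)%N ->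
    K i <= gproduct o (x n) (x m) /\ K i <= gproduct o (y n) (y m).
  have [N HN] := bx (K i + C); have [M HM] := by_ (K i + C).
  exists (maxn N M) => n m; rewrite !geq_max => /andP[n1 n2] /andP[m1 m2].
  by split; apply: base => //; [exact: HN|exact: HM].
(* The maximum over j <= i makes every later path comparable with the i-th one at its threshold K
   i. *)
pose nn i := maxn (maxn N0 i) (\max_(j < i.+1) N j).
have nN i j : (i <= j)%N -> (N i <= nn j)%N.
  move=> ij; rewrite leq_max; apply/orP; right.
  have ij' : (i < j.+1)%N by [].
  exact: (@leq_bigmax _ (fun l : 'I_j.+1 => N l) (Ordinal ij')).
have nn0 i : (N0 <= nn i)%N by apply: leq_trans (leq_maxl _ _); exact: leq_maxl.
have nni i : (i <= nn i)%N by apply: leq_trans (leq_maxl _ _); exact: leq_maxr.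
have K0 i : rho + 1 <= K i by have := ler0n R i.+1; rewrite /K; lra.
(* o lies on a short path from x n0 to y n0, where the product is at most h / 2; each end is then
   exchanged for a far term at the cost of one [delta]. *)
have oxy i : gproduct o (x (nn i)) (y (nn i)) <= h / 2 + 2 * delta.
  have h1 : h + 3 * delta + 1 <= gproduct o (x n0) (x (nn i)).
    apply: base => //; apply: le_trans (HN1 _ _ n0N1 _); first by rewrite /B0; lra.
    exact: leq_trans (leq_maxl _ _) (nn0 i).
  have h2 : h + 3 * delta + 1 <= gproduct o (y n0) (y (nn i)).
    apply: base => //; apply: le_trans (HN2 _ _ n0N2 _); first by rewrite /B0; lra.
    exact: leq_trans (leq_maxr _ _) (nn0 i).
  have := short_path_gproduct sh0 s00 s0L; rewrite b0x b0y -/o => h3.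
  have := hyp (Xx n0) (Xy n0) (Xx (nn i)) Xo.
  rewrite lerBlDr ge_min => /orP[h4|h4]; first by lra.
  have := hyp (Xx (nn i)) (Xy n0) (Xy (nn i)) Xo.
  rewrite (gproduct_sym o (Xy (nn i)) (Xy n0)).
  by rewrite lerBlDr ge_min => /orP[h5|h5]; lra.
have /choice[D HD] (i : nat) : exists D : (R -> T) * R * R,
    [/\ good D.1.1 D.1.2, short_path D.1.1 D.1.2, D.1.1 0 = x (nn i),
        D.1.1 D.1.2 = y (nn i) &
        [/\ 0 <= D.2, D.2 <= D.1.2 & k (D.1.1 D.2) o <= rho]].
  have [||//|beta [L [gb shb bx0 byL]]] := good_exists (x (nn i)) (y (nn i)).
  - by [].
  - by [].
  - have [hx hy] := HN i _ _ (nN i i (leqnn i)) (nN i i (leqnn i)).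
    move: hx hy; rewrite (gproduct_self Xo (Xx _)) (gproduct_self Xo (Xy _)).
    have := oxy i; have := K0 i; rewrite /gproduct /rho; lra.
  - have [s [s1 s2 s3]] := short_path_balanced shb Xo.
    exists (beta, L, s); split=> //=; split=> //.
    by apply: (le_trans s3); rewrite bx0 byL; have := oxy i; rewrite /rho; lra.
pose beta i := (D i).1.1; pose L i := (D i).1.2; pose s i := (D i).2.
exists beta, L, s, nn, o, rho.
have sP i : [/\ (i <= nn i)%N, i.+1%:R <= s i, s i + i.+1%:R <= L i &
    k (beta i (s i)) o <= rho].
  have [gb shb bx0 byL [s1 s2 s3]] := HD i; have [L0i bXi lip _] := shb.
  have [hx hy] := HN i _ _ (nN i i (leqnn i)) (nN i i (leqnn i)).
  rewrite (gproduct_self Xo (Xx _)) -bx0 in hx.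
  rewrite (gproduct_self Xo (Xy _)) -byL in hy.
  rewrite -/(beta i) -/(L i) -/(s i) in shb bx0 byL s1 s2 s3 hx hy L0i bXi lip *.
  have X0 := bXi 0 (lexx 0) L0i; have XL := bXi _ L0i (lexx (L i)).
  have Xs := bXi _ s1 s2.
  have t1 := ktri X0 Xs Xo; have t2 := ktri XL Xs Xo.
  have l1 := lip _ _ (lexx 0) s1 s2; have l2 := lip _ _ s1 s2 (lexx (L i)).
  rewrite (ksym Xs XL) in l2; rewrite /K in hx hy.
  by split=> //; lra.
split=> //; first by move=> i; have [? ? ? ? _] := HD i.
move=> i j t ij ti.
have ti' := ti; move: ti'; rewrite ler_norml => /andP[t1 t2].
have [_ si1 si2 si3] := sP i; have [_ sj1 sj2 sj3] := sP j.
have ij' : i.+1%:R <= j.+1%:R :> R by rewrite ler_nat.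
have [_ shi bx0i byLi _] := HD i; have [_ shj bx0j byLj _] := HD j.
rewrite -/(beta i) -/(L i) in shi bx0i byLi.
rewrite -/(beta j) -/(L j) in shj bx0j byLj.
have i0 : 0 <= i.+1%:R :> R by rewrite ler0n.
have Xsi : X (beta i (s i)) by have [_ H _ _] := shi; apply: H; lra.
have Xsj : X (beta j (s j)) by have [_ H _ _] := shj; apply: H; lra.
have Xtj : X (beta j (s j + t)) by have [_ H _ _] := shj; apply: H; lra.
have a1 := ktri Xsi Xo Xsj; rewrite (ksym Xo Xsj) in a1.
have a2 := ktri Xtj Xsj Xo.
have a3 : k (beta j (s j + t)) (beta j (s j)) <= i.+1%:R.
  have [_ _ lip _] := shj; have [t0|t0] := leP 0 t.
    have h1 : 0 <= s j by lra.
    have h2 : s j <= s j + t by lra.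
    have h3 : s j + t <= L j by lra.
    by have := lip _ _ h1 h2 h3; rewrite (ksym Xsj Xtj); lra.
  have h1 : 0 <= s j + t by lra.
  have h2 : s j + t <= s j by lra.
  have h3 : s j <= L j by lra.
  by have := lip _ _ h1 h2 h3; lra.
have [gx gy] := HN i _ _ (nN i i (leqnn i)) (nN i j ij).
have := @short_path_tracking (beta i) (L i) (beta j) (L j) o (s i) (s j) t shi shj Xo.
rewrite bx0i bx0j byLi byLj /= => H.
have := H ltac:(lra) ltac:(lra) ltac:(lra) ltac:(lra) ltac:(lra) ltac:(lra)
  ltac:(lra) ltac:(lra) ltac:(rewrite /K in gx; lra) ltac:(rewrite /K in gy; lra).
(* The centres are at most 2 * rho = 8 * delta + 3 * h apart, and tracking adds 4 * delta + 2 *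
   h. *)
by rewrite /rho in si3 sj3; lra.
Qed.

End FellowTravelling.

(** * Arcs and the Gromov boundary *)

Section Arcs.
Context {R : realType} {T : metricType R}.
Implicit Types (g : R -> T) (X : set T).

Lemma mdist_away g (a b : R) (p : T) : continuous_on g a b ->
  (forall t, a <= t -> t <= b -> g t <> p) ->
  exists2 n : R, 0 < n & forall t, a <= t -> t <= b -> n <= mdist p (g t).
Proof.
move=> cg gp; have [ab|ba] := leP a b; last first.
  by exists 1 => // t at_ tb; move: ba; rewrite ltNge (le_trans at_ tb).
have [|c + cm] := @EVT_min R (fun t => mdist p (g t)) a b ab.
  apply: real_within_continuous => c ac cb e e0.
  have [n n0 H] := cg c ac cb e e0; exists n => // u au ub uc.
  apply: le_lt_trans (H u au ub uc).
  have := metric_triangle p (g c) (g u); have := metric_triangle p (g u) (g c).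
  by rewrite (metric_sym (g u) (g c)) ler_norml; lra.
rewrite in_itv /= => /andP[ac cb]; exists (mdist p (g c)) => [|t at_ tb].
  by rewrite mdist_gt0; apply/eqP => E; exact: (gp c).
by apply: cm; rewrite in_itv /= at_ tb.
Qed.

(** The inverse is continuous at g t0 because the images of the compact intervals [0, t0 - e] and
    [t0 + e, 1] keep a positive distance from g t0. *)
Lemma arc_of_injective g : continuous_on g 0 1 ->
  (forall s t, 0 <= s -> s <= 1 -> 0 <= t -> t <= 1 -> g s = g t -> s = t) ->
  exists alpha : metric_arc T, arc_map alpha = g.
Proof.
move=> cg ginj.
pose c p := xget 0 [set t | [/\ 0 <= t, t <= 1 & g t = p]].
have cK : {in `[0, 1], cancel g c}.
  move=> t; rewrite in_itv /= => /andP[t0 t1].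
  have [h1 h2 /ginj] : [set s | [/\ 0 <= s, s <= 1 & g s = g t]] (c (g t)).
    by apply: xgetPex; exists t.
  exact.
have gC : {within `[0, 1], continuous g} by exact/within_continuousP.
suff cC : {within g @` `[0, 1], continuous c} by exists (Arc cK gC cC).
apply/subspace_continuousP => _ [t0 /= + <-]; rewrite in_itv /= => /andP[t00 t01].
have ct0 : c (g t0) = t0 by apply: cK; rewrite in_itv /= t00.
apply/cvgrPdist_lt => e e0; rewrite /from_subspace ct0.
have [|t t1 tb|n n0 H] := @mdist_away g 0 (t0 - e) (g t0).
- by apply: continuous_on_sub cg => //; lra.
- by move=> /ginj E; have := E t1 ltac:(lra) t00 t01; lra.
have [|t t1 tb|m m0 H'] := @mdist_away g (t0 + e) 1 (g t0).
- by apply: continuous_on_sub cg => //; lra.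
- by move=> /ginj E; have := E ltac:(lra) tb t00 t01; lra.
rewrite near_withinE; apply/nbhs_ballP; exists (Num.min n m) => /=.
  by rewrite lt_min n0.
move=> _ /[swap] -[t /= + <-]; rewrite in_itv /= => /andP[t1 t2].
have ct : c (g t) = t by apply: cK; rewrite in_itv /= t1.
rewrite ct ballEmdist /= lt_min => /andP[tn tm].
rewrite ltNge; apply/negP; rewrite ler_normr => /orP[h|h].
- by have := H t t1 ltac:(lra); lra.
- by have := H' t ltac:(lra) t2; lra.
Qed.

End Arcs.

(** * Boundary points in terms of explicit bounds, and existence of injective short paths *)

Section Assembly.
Context {R : realType} {T : metricType R}.
Variables (X : set T) (w : T).
Implicit Types (x y : nat -> T).

Lemma gromov_sequenceP x : gromov_sequence X w x <->
  (forall i, X (x i)) /\ tends_to_boundary (qh_dist X) w x.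
Proof.
split=> -[Xx H]; split=> //.
  move=> B; have /cvgryPge/(_ B) [[P Q] [/= [N _ PN] [M _ QM]] PQ] := H.
  exists (maxn N M) => n m; rewrite !geq_max => /andP[Nn Mn] /andP[Nm Mm].
  by apply: (PQ (n, m)); split; [exact: PN|exact: QM].
apply/cvgryPge => B; have [N HN] := H B.
exists ([set n | (N <= n)%N], [set n | (N <= n)%N]) => /=.
  by split; exists N.
by move=> [n m] /= [nN mN]; exact: HN.
Qed.

Lemma gromov_equivalentP x y : gromov_equivalent X w x y <->
  forall B : R, exists N, forall i, (N <= i)%N ->
    B <= gproduct (qh_dist X) w (x i) (y i).
Proof.
split=> [/cvgryPge H B|H].
  by have [N _ HN] := H B; exists N => i Ni; exact: HN.
by apply/cvgryPge => B; have [N HN] := H B; exists N.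
Qed.

Lemma quasihyperbolic_linked : quasihyperbolic_domain X ->
  forall p q, X p -> X q -> linked X p q.
Proof. by move=> [_ _]. Qed.

Lemma qh_dist_pseudometric : quasihyperbolic_domain X ->
  pseudometric_on X (qh_dist X).
Proof.
move=> XP; have [oX bX _] := XP; have lX := quasihyperbolic_linked XP.
have sX : X `<=` X by [].
split=> [p Xp|p q Xp Xq|p q Xp Xq|p q r Xp Xq Xr].
- exact: (qh_dist_in_self bX sX Xp).
- exact: (qh_dist_in_ge0 bX sX).
- exact: (qh_dist_in_sym oX bX sX (lX p q Xp Xq)).
- exact: (qh_dist_in_triangle oX bX sX (lX p q Xp Xq) (lX q r Xq Xr)).
Qed.

Definition injective_qh_param (g : R -> T) (L : R) := qh_param X X g L /\
  forall s t : R, 0 <= s -> s <= L -> 0 <= t -> t <= L -> g s = g t -> s = t.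

(** All of h is spent on approximating the infimum; making the curve injective does not lengthen
    it. *)
Lemma injective_short_path (h : R) p q : quasihyperbolic_domain X -> 0 < h ->
  X p -> X q -> exists g L, [/\ injective_qh_param g L,
    short_path X (qh_dist X) h g L, g 0 = p & g L = q].
Proof.
move=> XP h0 Xp Xq; have [oX bX _] := XP; have sX : X `<=` X by [].
have lX := quasihyperbolic_linked XP Xp Xq.
have [g0 [L0 [g0P g00 g0L lt_h]]] := qh_dist_in_approx oX bX sX lX h0.
have [g [L [gP ge0 geL LL0 ginj]]] := qh_arc_exists oX bX g0P.
exists g, L; rewrite ge0 geL g00 g0L; split=> //.
have [[Lge0 _ _ gX] _] := gP; split=> //.
- move=> s t s0 st tL; exact: (qh_dist_in_le_param bX sX gP s0 st tL).
- by rewrite ge0 geL g00 g0L; apply: le_trans LL0 _; exact: ltW.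
Qed.

(** Otherwise the two sequences would be equivalent, and hyperbolicity, as transitivity, would
    identify their classes. *)
Lemma boundary_points_apart (delta : R) x y : quasihyperbolic_domain X ->
  0 <= delta -> gromov_hyperbolic X delta -> X w ->
  gromov_sequence X w x -> gromov_sequence X w y ->
  [set z | gromov_sequence X w z /\ gromov_equivalent X w x z] <>
  [set z | gromov_sequence X w z /\ gromov_equivalent X w y z] ->
  exists B : R, forall N, exists2 n, (N <= n)%N &
    gproduct (qh_dist X) w (x n) (y n) < B.
Proof.
move=> XP d0 hyp Xw /gromov_sequenceP[Xx _] /gromov_sequenceP[Xy _].
have kP := qh_dist_pseudometric XP.
apply: contra_notP => /forallNP H.
have {}H B : exists N, forall n, (N <= n)%N ->
    B <= gproduct (qh_dist X) w (x n) (y n).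
  have /existsNP[N HN] := H B; exists N => n Nn; rewrite leNgt; apply/negP => lt.
  by apply: HN; exists n.
have tr (u v z : nat -> T) : (forall i, X (u i)) -> (forall i, X (v i)) ->
    (forall i, X (z i)) ->
    (forall B : R, exists N, forall n, (N <= n)%N ->
      B <= gproduct (qh_dist X) w (v n) (u n)) ->
    gromov_equivalent X w u z -> gromov_equivalent X w v z.
  move=> Xu Xv Xz vu /gromov_equivalentP uz; apply/gromov_equivalentP => B.
  have [N HN] := vu (B + delta); have [M HM] := uz (B + delta).
  exists (maxn N M) => i; rewrite geq_max => /andP[Ni Mi].
  have -> : B = B + delta - delta by lra.
  exact: (gproduct_min hyp _ _ _ _ (HN i Ni) (HM i Mi)).
apply/seteqP; split=> z [zs xz]; split=> //;
  have /gromov_sequenceP[Xz _] := zs; apply: tr xz => // B.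
have [N HN] := H B; exists N => n Nn.
by rewrite (gproduct_sym kP w (Xy n) (Xx n)); exact: HN.
Qed.

End Assembly.

(** * Arcs of length 2r centred at a point of a short path *)

Section CentredArcs.
Context {R : realType} {T : metricType R}.
Variables (X : set T) (beta : R -> T) (L s r : R) (alpha : metric_arc T).
Hypotheses (oX : open X) (bX : boundary X !=set0).
Hypotheses (betaP : injective_qh_param X beta L) (r0 : 0 < r) (rs : r <= s)
  (sL : s + r <= L).
Hypothesis alphaE :
  arc_map alpha = (fun t => beta (2 * r * t + (s - r))).

(* Signed quasihyperbolic length along [alpha] from its midpoint [beta s]. *)
Definition signed_length u : R := r * (2 * arc_coord alpha u - 1).

Lemma signed_lengthK (t : R) : `|t| <= r ->
  arc_set alpha (beta (s + t)) /\ signed_length (beta (s + t)) = t.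
Proof.
rewrite ler_norml => /andP[t1 t2]; pose c := (t / r + 1) / 2.
have rc : 2 * r * c = t + r by rewrite /c; field; rewrite gt_eqF.
have c0 : 0 <= c.
  by rewrite -(pmulr_rge0 _ (_ : 0 < 2 * r)) ?rc ?mulr_gt0//; lra.
have c1 : c <= 1.
  by rewrite -(ler_pM2l (_ : 0 < 2 * r)) ?rc ?mulr_gt0//; lra.
have c01 : c \in `[0, 1] by rewrite in_itv /= c0.
have bE : beta (s + t) = arc_map alpha c.
  by rewrite alphaE rc; congr beta; lra.
split; first by exists c.
by rewrite /signed_length bE (arc_mapK alpha c01); lra.
Qed.

Lemma arc_set_signed_length u : arc_set alpha u ->
  `|signed_length u| <= r /\ beta (s + signed_length u) = u.
Proof.
move=> [c /= c01 <-]; rewrite /signed_length (arc_mapK alpha c01).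
have R0 := r0; move: c01; rewrite in_itv /= => /andP[c0 c1].
split; first by rewrite ler_norml; nra.
by rewrite alphaE; congr beta; lra.
Qed.

Lemma centred_arc_length (c d : R) : 0 <= c -> c <= d -> d <= 1 ->
  curve_in X (arc_map alpha) c d /\
  qh_length X (arc_map alpha) c d = 2 * r * (d - c).
Proof.
move=> c0 cd d1; have [[bC bq] _] := betaP; have R0 := r0; have Rs := rs.
have SL := sL; have r20 : 0 < 2 * r by lra.
have h1 : 0 <= 2 * r * c + (s - r) by nra.
have h2 : 2 * r * c + (s - r) <= 2 * r * d + (s - r) by nra.
have h3 : 2 * r * d + (s - r) <= L by nra.
have [h4 h5] := curve_in_affine oX bX r20 (@subset_refl _ X) cd
  (curve_in_sub h1 h2 h3 bC).
by rewrite alphaE; split=> //; rewrite qlenE h5 bq//; lra.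
Qed.

Lemma subarc_signed_length u v : arc_set alpha u -> arc_set alpha v ->
  subarc_qh_length X alpha u v = `|signed_length u - signed_length v|.
Proof.
move=> [c /= c01 <-] [d /= d01 <-].
rewrite /subarc_qh_length /signed_length (arc_mapK alpha c01) (arc_mapK alpha d01).
have R0 := r0.
move: c01 d01; rewrite !in_itv /= => /andP[c0 c1] /andP[d0 d1].
have -> : r * (2 * c - 1) - r * (2 * d - 1) = 2 * r * (c - d) by ring.
have r20 : 0 <= 2 * r by lra.
rewrite normrM (ger0_norm r20); have [cd|dc] := leP c d.
  by rewrite (centred_arc_length c0 cd d1).2 distrC ger0_norm ?subr_ge0.
by rewrite (centred_arc_length d0 (ltW dc) c1).2 gtr0_norm ?subr_gt0.
Qed.

Lemma centred_arc_short (h : R) : short_path X (qh_dist X) h beta L ->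
  pseudometric_on X (qh_dist X) ->
  qh_short_arc X h (beta (s - r)) (beta (s + r)) alpha.
Proof.
move=> shb kP; have [cA qA] := centred_arc_length (lexx 0) ler01 (lexx 1).
have [_ _ rA XA] := cA; have R0 := r0; have Rs := rs; have SL := sL.
split=> //.
  split.
  - by rewrite alphaE; congr beta; lra.
  - by rewrite alphaE; congr beta; lra.
  - by move=> _ [t /= + <-]; rewrite in_itv /= => /andP[]; exact: XA.
rewrite /arc_qh_length qA.
have := short_path_ge kP shb (_ : 0 <= s - r) (_ : s - r <= s + r) SL.
by move=> /(_ ltac:(lra) ltac:(lra)); lra.
Qed.

End CentredArcs.

Unset Implicit Arguments.

Theorem theorem1p4 (R : realType) (T : metricType R) (X : set T)
    (delta h : R) (w : T) (a b : set (nat -> T)) :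
  quasihyperbolic_domain X ->
  0 <= delta -> gromov_hyperbolic X delta ->
  X w -> gromov_boundary X w a -> gromov_boundary X w b -> a <> b ->
  0 < h ->
  exists (x y : nat -> T) (alpha : nat -> metric_arc T) (f : nat -> nat -> T -> T),
    [/\ a x, b y & forall i, arc_in X (x i) (y i) (alpha i)] /\
    [/\ forall i, qh_short_arc X h (x i) (y i) (alpha i),
        exists s, [/\ arc_set (alpha 0%N) s,
          qh_dist X (x i) s @[i --> \oo] --> +oo
          & qh_dist X (y i) s @[i --> \oo] --> +oo],
        [/\ forall i j, (i <= j)%N -> length_map X (alpha i) (alpha j) (f i j),
            forall i u, arc_set (alpha i) u -> f i i u = u
          & forall i j m u, (i <= j)%N -> (j <= m)%N -> arc_set (alpha i) u ->
              f i m u = f j m (f i j u)]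
      & forall i j u, (i <= j)%N -> arc_set (alpha i) u ->
          qh_dist X (f i j u) u <= 12 * (delta + h)].
Proof.
move=> XP d0 hyp Xw [xs xsG <-] [ys ysG <-] ab h0.
have [oX bX _] := XP; have kP := qh_dist_pseudometric XP.
have ksym p q : X p -> X q -> qh_dist X p q = qh_dist X q p.
  by case: kP => _ _ + _ => /[apply] /[apply].
have ktri p q r : X p -> X q -> X r ->
    qh_dist X p r <= qh_dist X p q + qh_dist X q r.
  by case: kP => _ _ _ H; exact: H.
have apart := boundary_points_apart XP d0 hyp Xw xsG ysG ab.
have [Xxs xsw] := (gromov_sequenceP X w xs).1 xsG.
have [Xys ysw] := (gromov_sequenceP X w ys).1 ysG.
have [beta [L [s [n [c [rho [Xc betaP sP track]]]]]]] :=
  fellow_travelling_paths kP hyp d0 (ltW h0)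
    (fun p q Xp Xq _ => injective_short_path XP h0 Xp Xq) Xw Xxs Xys xsw ysw apart.
pose r i : R := i.+1%:R.
have r0 i : 0 < r i by rewrite ltr0n.
have rs i : r i <= s i by have [] := sP i.
have sL i : s i + r i <= L i by have [] := sP i.
have good i : injective_qh_param X (beta i) (L i) by have [] := betaP i.
have shb i : short_path X (qh_dist X) h (beta i) (L i) by have [] := betaP i.
have rij i j : (i <= j)%N -> r i <= r j by rewrite ler_nat ltnS.
have Xb i t : `|t| <= r i -> X (beta i (s i + t)).
  rewrite ler_norml => /andP[t1 t2]; have [_ H _ _] := shb i.
  by have := rs i; have := sL i => *; apply: H; lra.
have /choice[alpha alphaE] (i : nat) : exists alpha : metric_arc T,
    arc_map alpha = (fun t => beta i (2 * r i * t + (s i - r i))).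
  have [[bC _] binj] := good i.
  have := r0 i; have := rs i; have := sL i => h1 h2 h3; have r20 : 0 < 2 * r i by lra.
  apply: arc_of_injective.
    have [|[_ cg _ _] _] := @curve_in_affine _ _ X oX bX X (beta i) (2 * r i)
        (s i - r i) 0 1 r20 (@subset_refl _ X) ler01.
      by apply: curve_in_sub bC; lra.
    exact: cg.
  move=> t u t0 t1 u0 u1 /binj E.
  have := E ltac:(nra) ltac:(nra) ltac:(nra) ltac:(nra).
  by move=> /addIr /(mulfI (lt0r_neq0 r20)).
pose tau i u := signed_length (r i) (alpha i) u.
have tauK i t : `|t| <= r i ->
    arc_set (alpha i) (beta i (s i + t)) /\ tau i (beta i (s i + t)) = t.
  exact: (signed_lengthK (r0 i) (alphaE i)).
have setP i u : arc_set (alpha i) u -> `|tau i u| <= r i /\ beta i (s i + tau i u) = u.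
  exact: (arc_set_signed_length (r0 i) (alphaE i)).
have subarcE i u v : arc_set (alpha i) u -> arc_set (alpha i) v ->
    subarc_qh_length X (alpha i) u v = `|tau i u - tau i v|.
  exact: (subarc_signed_length oX bX (good i) (r0 i) (rs i) (sL i) (alphaE i)).
pose x i := beta i (s i - r i); pose y i := beta i (s i + r i).
have shA i : qh_short_arc X h (x i) (y i) (alpha i).
  exact: (centred_arc_short oX bX (good i) (r0 i) (rs i) (sL i) (alphaE i) (shb i) kP).
have nr i : `|- r i| <= r i by rewrite normrN gtr0_norm.
have pr i : `|r i| <= r i by rewrite gtr0_norm.
have zr i : `|0 : R| <= r i by rewrite normr0 ltW.
have Xx i : X (x i) by exact: (Xb i _ (nr i)).
have Xy i : X (y i) by exact: (Xb i _ (pr i)).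
have Xs i : X (beta i (s i)) by rewrite -[s i]addr0; exact: Xb.
(* The loss h + rho of [short_path_shadow], and the change of base point from c to w. *)
pose D := h + rho + qh_dist X w c.
have shadow i : i%:R - D <= gproduct (qh_dist X) w (xs (n i)) (x i) /\
    i%:R - D <= gproduct (qh_dist X) w (ys (n i)) (y i).
  have [_ _ bx0 byL] := betaP i; have [_ _ _ so] := sP i.
  have := short_path_shadow kP (shb i) Xc (ltW (r0 i)) (rs i) (sL i) so.
  rewrite bx0 byL -/(x i) -/(y i) => -[h1 h2].
  have := gproduct_base kP Xc Xw (Xxs (n i)) (Xx i).
  have := gproduct_base kP Xc Xw (Xys (n i)) (Xy i).
  have ri : i%:R <= r i by rewrite ler_nat.
  by rewrite /D; lra.
have ni i : (i <= n i)%N by have [] := sP i.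
have [xw xsx] := boundary_shadow kP hyp d0 Xw Xxs Xx xsw ni (fun i => (shadow i).1).
have [yw ysy] := boundary_shadow kP hyp d0 Xw Xys Xy ysw ni (fun i => (shadow i).2).
exists x, y, alpha, (fun i j u => beta j (s j + tau i u)); split.
  split; last by move=> i; have [] := shA i.
  - by split; [exact/gromov_sequenceP|exact/gromov_equivalentP].
  - by split; [exact/gromov_sequenceP|exact/gromov_equivalentP].
(* All centres lie within [rho] of c, so distances to the centre of the first arc and to that of the
   i-th differ by at most 2 * rho. *)
have far (z : nat -> T) : (forall i, X (z i)) ->
    (forall i, r i - h <= qh_dist X (z i) (beta i (s i))) ->
    qh_dist X (z i) (beta 0%N (s 0%N)) @[i --> \oo] --> +oo.
  move=> Xz Hz; apply/cvgryPge => B.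
  exists (Num.truncn `|B + h + 2 * rho|) => // i /= Bi.
  have ri : `|B + h + 2 * rho| <= r i.
    by apply: le_trans (ltW (truncnS_gt _)) _; rewrite ler_nat.
  have := le_trans (ler_norm _) ri; have := Hz i.
  have [_ _ _ soi] := sP i; have [_ _ _ so0] := sP 0%N.
  have := ktri (z i) (beta 0%N (s 0%N)) (beta i (s i)) (Xz i) (Xs _) (Xs i).
  have := ktri (beta 0%N (s 0%N)) c (beta i (s i)) (Xs _) Xc (Xs i).
  by rewrite (ksym c (beta i (s i)) Xc (Xs i)); lra.
split; first exact: shA.
(* Indices start at 0, so this is the midpoint of the first arc. *)
- exists (beta 0%N (s 0%N)); split.
  + by have [+ _] := tauK 0%N 0 (zr 0%N); rewrite addr0.
  + apply: far => // i; have := r0 i; have := rs i; have := sL i => *.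
    have := short_path_ge kP (shb i) (_ : 0 <= s i - r i) (_ : s i - r i <= s i).
    by move=> /(_ ltac:(lra) ltac:(lra) ltac:(lra)); rewrite -/(x i); lra.
  + apply: far => // i; have := r0 i; have := rs i; have := sL i => *.
    have := short_path_ge kP (shb i) (_ : 0 <= s i) (_ : s i <= s i + r i).
    move=> /(_ ltac:(lra) ltac:(lra) ltac:(lra)).
    by rewrite -/(y i) (ksym (y i)) //; lra.
- split=> [i j ij|i u iu|i j m u ij jm iu].
  + split.
    * rewrite /arc_qh_length.
      have [_ ->] := centred_arc_length oX bX (good i) (r0 i) (rs i) (sL i)
        (alphaE i) (lexx 0) ler01 (lexx 1).
      have [_ ->] := centred_arc_length oX bX (good j) (r0 j) (rs j) (sL j)
        (alphaE j) (lexx 0) ler01 (lexx 1).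
      by have := rij i j ij; lra.
    * move=> _ [u iu <-]; have [ui _] := setP i u iu.
      exact: (tauK j _ (le_trans ui (rij i j ij))).1.
    * move=> u v iu iv; have [ui _] := setP i u iu; have [vi _] := setP i v iv.
      have [ju tu] := tauK j _ (le_trans ui (rij i j ij)).
      have [jv tv] := tauK j _ (le_trans vi (rij i j ij)).
      by rewrite !subarcE// tu tv.
  + exact: (setP i u iu).2.
  + have [ui _] := setP i u iu.
    by have [_ ->] := tauK j _ (le_trans ui (rij i j ij)).
- move=> i j u ij iu; have [ui {2}<-] := setP i u iu.
  have h1 := Xb i _ ui; have h2 := Xb j _ (le_trans ui (rij i j ij)).
  by rewrite ksym//; exact: track.
Qed.
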